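(* Let $N$ be a compact non-orientable smooth manifold. Then the simple Morse pseudo-functions on $N$ form an open and dense subset of the space $\widetilde\Omega^0(N)$ of all smooth pseudo-functions on $N$, in the $C^2$-topology.
   Context: Manifolds are smooth and without boundary. Orientation double cover: $\widetilde N$ is the manifold of pairs $(x,\mathcal O)$, where $x\in N$ and $\mathcal O$ is an orientation of $T_xN$. The map $I\colon\widetilde N\to\widetilde N$, $(x,\mathcal O)\mapsto(x,-\mathcal O)$, is a fixed-point-free involution (orientation-reversing for the canonical orientation of $\widetilde N$). Pseudo-functions: a pseudo-function on $N$ is a smooth section of the orientation line bundle of $N$; equivalently, it is a smooth function $\widetilde F\colon\widetilde N\to\mathbb R$ with $\widetilde F\circ I=-\widetilde F$ (its lift to $\widetilde N$). Thus the space $\widetilde\Omega^0(N)$ of pseudo-functions is identified with $\Omega^0_{odd}(\widetilde N)=\{\widetilde F\in C^\infty(\widetilde N):\widetilde F\circ I=-\widetilde F\}$. The $C^2$-topology on $\widetilde\Omega^0(N)$ is the one induced on $\Omega^0_{odd}(\widetilde N)$ by the $C^2$-topology on $C^\infty(\widetilde N)$. A smooth function is Morse if all its critical points are non-degenerate; a Morse function is simple if distinct critical points have distinct critical values. A pseudo-function on $N$ is simple Morse if its lift $\widetilde F$ to $\widetilde N$ is a simple Morse function. *)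

(* Defs.v *)
From HB Require Import structures.
From mathcomp Require Import all_boot all_order all_algebra.
From mathcomp Require Import all_classical all_reals all_analysis.

Set Implicit Arguments.
Unset Strict Implicit.
Unset Printing Implicit Defensive.

Import Order.TTheory GRing.Theory Num.Theory.
Import numFieldNormedType.Exports.

Local Open Scope classical_set_scope.
Local Open Scope ring_scope.

Section Euclidean.
Context {R : realType} {n : nat} {V : normedModType R}.

(* iter_partial [:: i1; ...; ik] f is d_i1 ... d_ik f. *)
Definition iter_partial (s : seq 'I_n) (f : 'rV[R]_n -> V) : 'rV[R]_n -> V :=
  foldr (fun i g => fun y => 'D_(delta_mx 0 i) g y) f s.

(* C^infty on U, for U open: only the germs of f at points of U matter. *)
Definition smooth_on (U : set 'rV[R]_n) (f : 'rV[R]_n -> V) : Prop :=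
  forall (s : seq 'I_n) (y : 'rV[R]_n), U y ->
    {for y, continuous (iter_partial s f)} /\
    forall i : 'I_n, derivable (iter_partial s f) y (delta_mx 0 i).

End Euclidean.

(* The values of chart_map outside chart_dom are irrelevant. *)
Record chart (R : realType) (n : nat) (M : Type) := Chart {
  chart_dom : set M;
  chart_map : M -> 'rV[R]_n }.

Section Charts.
Context {R : realType} {n : nat} {M : Type}.
Implicit Types (c : chart R n M) (A : set (chart R n M)).

(* f \o (chart_map c)^-1 on chart_map c @` chart_dom c, and 0 elsewhere. *)
Definition local_rep (V : zmodType) c (f : M -> V) (y : 'rV[R]_n) : V :=
  xget 0 [set f x | x in chart_dom c `&` chart_map c @^-1` [set y]].

Definition transition c c' : 'rV[R]_n -> 'rV[R]_n := local_rep c (chart_map c').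

Definition smooth A (f : M -> R) : Prop :=
  forall c, A c -> smooth_on (chart_map c @` chart_dom c) (local_rep c f).

Definition critical_point A (f : M -> R) (x : M) : Prop :=
  forall c, A c -> chart_dom c x ->
    forall i, iter_partial [:: i] (local_rep c f) (chart_map c x) = 0.

Definition hessian c (f : M -> R) (x : M) : 'M[R]_n :=
  \matrix_(i, j) iter_partial [:: i; j] (local_rep c f) (chart_map c x).

Definition nondegenerate A (f : M -> R) (x : M) : Prop :=
  forall c, A c -> chart_dom c x -> hessian c f x \in unitmx.

Definition morse A (f : M -> R) : Prop :=
  smooth A f /\ forall x, critical_point A f x -> nondegenerate A f x.

Definition simple_morse A (f : M -> R) : Prop :=
  morse A f /\
  forall x y, critical_point A f x -> critical_point A f y ->
    x <> y -> f x <> f y.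

Record smooth_fun A := SmoothFun {
  smooth_fun_val :> M -> R;
  smooth_funP : smooth A smooth_fun_val }.

HB.instance Definition _ A := gen_eqMixin (smooth_fun A).
HB.instance Definition _ A := gen_choiceMixin (smooth_fun A).

(* The C^2-topology is generated by the sets C2_nbhd f c K e, i.e. it is uniform
   convergence of the partial derivatives of order at most 2 on the compact
   subsets of the charts (for compact M the weak and strong C^2-topologies
   coincide). *)
Definition C2_nbhd A (f : smooth_fun A) c (K : set 'rV[R]_n) (e : R) :
    set (smooth_fun A) :=
  [set g | forall (s : seq 'I_n) y, (size s <= 2)%N -> K y ->
    `|iter_partial s (local_rep c g) y - iter_partial s (local_rep c f) y| < e].

Definition C2_subbase A : set (set (smooth_fun A)) :=
  [set B | exists f c K e,
    [/\ A c, compact K, K `<=` chart_map c @` chart_dom c, 0 < e &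
        B = C2_nbhd f c K e]].

HB.instance Definition _ A :=
  isSubBaseTopological.Build (smooth_fun A) (@C2_subbase A) id.

End Charts.

Section Manifold.
Context {R : realType} {n : nat} {N : topologicalType}.

(* chart_map c is a homeomorphism from the open set chart_dom c onto an open
   set. *)
Definition is_chart (c : chart R n N) : Prop :=
  [/\ open (chart_dom c),
      {in chart_dom c &, injective (chart_map c)},
      {in chart_dom c, continuous (chart_map c)} &
      forall U, open U -> U `<=` chart_dom c -> open (chart_map c @` U)].

Definition smooth_manifold (A : set (chart R n N)) : Prop :=
  [/\ hausdorff_space N,
      @second_countable N,
      forall c, A c -> is_chart c,
      forall x, exists2 c, A c & chart_dom c x &
      forall c c', A c -> A c' ->
        smooth_on (chart_map c @` (chart_dom c `&` chart_dom c'))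
                  (transition c c')].

End Manifold.

Section Orientation.
Context {R : realType} {n : nat} {N : Type}.
Variable A : set (chart R n N).

Definition chart_at (x : N) (c : chart R n N) : Prop := A c /\ chart_dom c x.

(* A tangent vector at x is the family of its coordinate vectors in the charts
   at x, related by the differentials of the transition maps; the coordinates
   in the other charts are 0 by convention. This is a linear subspace of
   chart R n N -> 'rV[R]_n. *)
Definition tangent_space (x : N) : set (chart R n N -> 'rV[R]_n) :=
  [set v | (forall c, ~ chart_at x c -> v c = 0) /\
    forall c c', chart_at x c -> chart_at x c' ->
      v c' = v c *m 'J (transition c c') (chart_map c x)].

(* Since dim T_xN = n, linear independence suffices. *)
Record tangent_basis (x : N) := TangentBasis {
  basis_vec :> 'I_n -> chart R n N -> 'rV[R]_n;
  basis_tangent : forall i, tangent_space x (basis_vec i);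
  basis_free : forall a : 'I_n -> R,
    \sum_i a i *: basis_vec i = 0 -> forall i, a i = 0 }.

Definition same_orientation (x : N) (b b' : tangent_basis x) : Prop :=
  exists2 P : 'M[R]_n, 0 < \det P & forall i, b' i = \sum_j P i j *: b j.

(* An orientation is given by its set of positive bases, one of the two classes
   for same_orientation. In dimension 0, where there is only one basis, this is
   a choice of sign. *)
Record orientation (x : N) := Orientation {
  positive_basis : set (tangent_basis x);
  orientationP : forall b b', same_orientation b b' <->
    (positive_basis b <-> positive_basis b') }.

Lemma opp_orientation_subproof (x : N) (O : orientation x) b b' :
  same_orientation b b' <->
  ((~` positive_basis O) b <-> (~` positive_basis O) b').
Proof.
rewrite (orientationP O) /setC /=.
by case: (pselect (positive_basis O b)); case: (pselect (positive_basis O b'));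
  tauto.
Qed.

Definition opp_orientation (x : N) (O : orientation x) : orientation x :=
  Orientation (@opp_orientation_subproof x O).

(* The basis of coordinate vectors d/dx_i of the chart c is positive. *)
Definition chart_positive (c : chart R n N) (x : N) (O : orientation x) :
    Prop :=
  exists2 b, positive_basis O b & forall i, b i c = delta_mx 0 i.

Definition double_cover : Type := {x : N & orientation x}.

Definition cover_involution (p : double_cover) : double_cover :=
  existT _ (projT1 p) (opp_orientation (projT2 p)).

(* Each chart c of N lifts to two charts of the double cover, over the points
   of chart_dom c at which c is positive (s = true), resp. negative (s = false).
   The manifold structure of the double cover, including its topology, is the
   one for which these charts form a smooth atlas. *)
Definition cover_chart (c : chart R n N) (s : bool) : chart R n double_cover :=
  Chart [set p | chart_dom c (projT1 p) /\ (chart_positive c (projT2 p) <-> s)]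
        (fun p => chart_map c (projT1 p)).

Definition cover_atlas : set (chart R n double_cover) :=
  [set cover_chart c s | c in A & s in [set: bool]].

(* As a type, it carries the topology induced by the C^2-topology of
   smooth_fun cover_atlas. *)
Definition pseudo_functions : set (smooth_fun cover_atlas) :=
  [set F | forall p, F (cover_involution p) = - F p].

Definition simple_morse_pseudo_functions : set pseudo_functions :=
  [set F | simple_morse cover_atlas (set_val F : smooth_fun cover_atlas)].

End Orientation.

Arguments orientation {R n N} A x.
Arguments double_cover {R n N} A.
Arguments cover_atlas {R n N} A.
Arguments pseudo_functions {R n N} A.
Arguments simple_morse_pseudo_functions {R n N} A.

(* A continuous choice of orientations of the tangent spaces. *)
Definition orientable (R : realType) (n : nat) (N : topologicalType)
    (A : set (chart R n N)) : Prop :=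
  exists O : forall x, orientation A x,
    forall c x, A c -> chart_dom c x ->
      \forall y \near x, chart_positive c (O y) <-> chart_positive c (O x).

(* Main.v *)
Require Import Defs.
From HB Require Import structures.
From mathcomp Require Import all_boot all_order all_algebra.
From mathcomp Require Import all_classical all_reals all_analysis.
From mathcomp Require Import ring lra zify.

Set Implicit Arguments.
Unset Strict Implicit.
Unset Printing Implicit Defensive.

Import Order.TTheory GRing.Theory Num.Theory.
Import numFieldNormedType.Exports.

Local Open Scope classical_set_scope.
Local Open Scope ring_scope.

(** In a chart c of N a pseudo-function F is an ordinary function f_c, and f_c
    and f_c' differ by composition with the transition map and by a locally
    constant sign, the sign of its Jacobian. Hence criticality and
    nondegeneracy of F at a point of N can be tested in one chart, and F is
    simple Morse iff its critical points are nondegenerate and the absolute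
    values of F at them are nonzero and pairwise distinct.

    Openness follows from compactness of N and of N x N: all conditions are
    inequalities in the 2-jet, except at a pair (x, x) with x critical, where
    invertibility of the Hessian makes the gradient injective near x, uniformly
    for nearby functions.

    For density, adding a small linear function a.y times a bump function
    makes f_c nondegenerate on a small ball as soon as -a is a regular value of
    its gradient; regular values are dense by Sard's theorem for equal
    dimensions. By compactness, finitely many such perturbations make F Morse.
    Its critical points x_1, ..., x_k are then isolated, and F + t (B_1 + 2 B_2
    + ... + k B_k), where B_i is a bump pseudo-function equal to +1 or -1 near
    x_i, has the same critical points and, for small t <> 0, nonzero critical
    values with distinct absolute values. *)

(** * Calculus on row vectors *)

(** All local work is done on [rep c F], the representative of [F] in the lift of [c] to the points
    where [c] is positive. Over each point of [N] lie two points of the cover with opposite values;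
    hence simplicity on the cover becomes two conditions on absolute values on [N].

    Sard's theorem is obtained by counting rather than by measure: if all small values were
    critical, a lattice of them would have more points than cells and residues can tell apart.

    Stability is proved once, along an arbitrary filter, for functions [g i] tending to [F] and
    points [X i] tending to [x]. The product of the neighbourhood filters of points and of [F], with
    the covering form of compactness, gives openness; a constant family isolates critical points;
    [t] tending to 0 controls the last perturbation. Two critical points may collide in the limit,
    where comparing values says nothing; this is why the gradient has to be injective uniformly for
    nearby functions.

    The weights 1, ..., k of the last perturbation have nonzero differences and nonzero sums, so
    neither equal nor opposite critical values survive for small nonzero [t]. *)

Section Limits.
Context {R : realType} {T : Type} (F : set_system T) {FF : Filter F}.

Lemma cvg_sumR (I : Type) (r : seq I) (P : pred I) (f : I -> T -> R) (a : I -> R) :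
  (forall i, P i -> f i x @[x --> F] --> a i) ->
  \sum_(i <- r | P i) f i x @[x --> F] --> \sum_(i <- r | P i) a i.
Proof. exact: (cvg_big (@add_continuous R^o)). Qed.

Lemma cvg_prodR (I : Type) (r : seq I) (P : pred I) (f : I -> T -> R) (a : I -> R) :
  (forall i, P i -> f i x @[x --> F] --> a i) ->
  \prod_(i <- r | P i) f i x @[x --> F] --> \prod_(i <- r | P i) a i.
Proof. exact: (cvg_big (@mul_continuous R)). Qed.

Lemma cvg_det n (f : T -> 'M[R]_n) (a : 'M[R]_n) :
  (forall i j, f x i j @[x --> F] --> a i j) -> \det (f x) @[x --> F] --> \det a.
Proof.
move=> H; apply: cvg_sumR => s _; apply: cvgM; first exact: cvg_cst.
by apply: cvg_prodR => i _; exact: H.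
Qed.

End Limits.

Section Coordinates.
Context {R : realType} {n : nat}.
Implicit Types (x y z : 'rV[R]_n) (f : 'rV[R]_n -> R).

Definition basis_row (i : 'I_n) : 'rV[R]_n := delta_mx 0 i.

Lemma basis_rowE i j : basis_row i 0 j = (i == j)%:R.
Proof. by rewrite /basis_row mxE eqxx /= eq_sym. Qed.

Lemma norm_coord y i : `|y 0 i| <= `|y|.
Proof.
rewrite [leRHS]/Num.Def.normr/= mx_normrE.
exact: (le_bigmax _ (fun ij : 'I_1 * 'I_n => `|y ij.1 ij.2|) (0, i)).
Qed.

Lemma norm_rV_le y (r : R) : 0 <= r -> (forall i, `|y 0 i| <= r) -> `|y| <= r.
Proof.
move=> r0 H; rewrite [leLHS]/Num.Def.normr/= mx_normrE.
by apply: bigmax_le => //= -[i j] _; rewrite ord1.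
Qed.

Lemma coord_sum y : y = \sum_i y 0 i *: basis_row i.
Proof. exact: row_sum_delta. Qed.

(** The endpoints may come in either order, so that increments of either sign are treated alike. *)
Definition between (a b t : R) := Num.min a b <= t <= Num.max a b.

Lemma between_dist (a b t c r : R) : between a b t ->
  `|a - c| <= r -> `|b - c| <= r -> `|t - c| <= r.
Proof.
by rewrite /between !ler_norml; case: (leP a b) => ab /andP[? ?] /andP[? ?] /andP[? ?];
  apply/andP; split; lra.
Qed.

Lemma partial_line f y (v : 'rV[R]_n) (s : R) :
  derivable f (y + s *: v) v ->
  is_derive s (1 : R) (fun t : R => f (y + t *: v)) ('D_v f (y + s *: v)).
Proof.
have E : (fun h : R => h^-1 *: (((fun t : R => f (y + t *: v)) \o shift s) (h *: (1:R))
    - f (y + s *: v))) = (fun h : R => h^-1 *: ((f \o shift (y + s *: v)) (h *: v) - f (y + s *: v))).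
  apply/funext => h /=; congr (_ *: (f _ - _)).
  by rewrite [_ *: 1]mulr1 scalerDl addrA [RHS]addrC addrAC.
move=> df; split; first by rewrite /derivable E.
by rewrite /derive E.
Qed.

Lemma partial_MVT f y (v : 'rV[R]_n) (t : R) :
  (forall s, between 0 t s -> derivable f (y + s *: v) v) ->
  exists2 s, between 0 t s & f (y + t *: v) - f y = t * 'D_v f (y + s *: v).
Proof.
rewrite /between.
have H (a b : R) : a <= b ->
    (forall s, a <= s <= b -> derivable f (y + s *: v) v) ->
    exists2 s, a <= s <= b & f (y + b *: v) - f (y + a *: v) = (b - a) * 'D_v f (y + s *: v).
  move=> ab df.
  have [||c + ->] := @MVT_segment R (fun t => f (y + t *: v))
      (fun s => 'D_v f (y + s *: v)) a b ab.
  - move=> s sab; apply: partial_line; apply: df.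
    by move: sab; rewrite in_itv/= => /andP[/ltW -> /ltW ->].
  - apply: derivable_within_continuous => s; rewrite in_itv/= => sab.
    by have [] := partial_line (df _ sab).
  by rewrite in_itv/= => cab; exists c => //; rewrite mulrC.
case: (leP 0 t) => t0 df.
  have [s st E] := H _ _ t0 df; exists s => //.
  by move: E; rewrite scale0r addr0 subr0.
have [s st E] := H _ _ (ltW t0) df; exists s => //.
move: E; rewrite scale0r addr0 sub0r => E.
by rewrite -opprB E mulNr opprK.
Qed.

Definition boxed x z y := forall j, between (x 0 j) (z 0 j) (y 0 j).

Lemma boxed_dist x z y c (r : R) : boxed x z y ->
  `|x - c| <= r -> `|z - c| <= r -> `|y - c| <= r.
Proof.
move=> B xr zr; have r0 : 0 <= r by apply: le_trans xr.
apply: norm_rV_le => // i; rewrite !mxE.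
apply: (between_dist (B i)).
  by apply: le_trans xr; have := norm_coord (x - c) i; rewrite !mxE.
by apply: le_trans zr; have := norm_coord (z - c) i; rewrite !mxE.
Qed.

(** The coordinates are changed one at a time, and each change is an instance of the mean value
    theorem. Only partial derivatives are needed, and the points [w i] stay in the box spanned by
    [x] and [z]. *)
Lemma increment f x z :
  (forall y, boxed x z y -> forall i, derivable f y (basis_row i)) ->
  exists2 w : 'I_n -> 'rV[R]_n, (forall i, boxed x z (w i)) &
    f z - f x = \sum_i (z - x) 0 i * 'D_(basis_row i) f (w i).
Proof.
move=> df.
(* [hyb k] has its first [k] coordinates from [z] and the others from [x]; the sum telescopes from
   [hyb 0 = x] to [hyb n = z]. *)
pose hyb (k : nat) : 'rV[R]_n := \row_j (if (j < k)%N then z 0 j else x 0 j).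
have hybS (i : 'I_n) : hyb i.+1 = hyb i + (z - x) 0 i *: basis_row i.
  apply/rowP => j; rewrite !mxE eqxx /= ltnS leq_eqVlt.
  have [->|ji] := eqVneq j i; first by rewrite eqxx ltnn /= mulr1 addrC subrK.
  by rewrite -(inj_eq val_inj) in ji; rewrite (negbTE ji) /= mulr0 addr0.
have step (i : 'I_n) : exists w, boxed x z w /\
    f (hyb i.+1) - f (hyb i) = (z - x) 0 i * 'D_(basis_row i) f w.
  have box s : between 0 ((z - x) 0 i) s -> boxed x z (hyb i + s *: basis_row i).
    move=> bs j; rewrite !mxE eqxx /=; have [->|ji] := eqVneq j i.
      rewrite ltnn mulr1; move: bs; rewrite /between !mxE.
      case: (leP 0 (z 0 i - x 0 i)) => h /andP[? ?];
      case: (leP (x 0 i) (z 0 i)) => h'; apply/andP; split; lra.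
    rewrite mulr0 addr0 /between; case: ifP => _; case: (leP (x 0 j) (z 0 j)) => h;
      apply/andP; split; lra.
  have [|s bs E] := @partial_MVT f (hyb i) (basis_row i) ((z - x) 0 i).
    by move=> s bs; apply: df; apply: box.
  by exists (hyb i + s *: basis_row i); split; [exact: box | rewrite hybS].
have [w wP] := choice step; exists w => [i|]; first by have [] := wP i.
under eq_bigr do rewrite -(wP _).2.
rewrite -(big_mkord xpredT (fun i => f (hyb i.+1) - f (hyb i))) telescope_sumr //.
congr (f _ - f _); apply/rowP => j; rewrite !mxE ?ltn_ord //.
Qed.

Lemma lipschitz_box f c (r L : R) :
  (forall y, `|y - c| <= r -> forall i,
     derivable f y (basis_row i) /\ `|'D_(basis_row i) f y| <= L) ->
  forall x z, `|x - c| <= r -> `|z - c| <= r ->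
  `|f z - f x| <= n%:R * L * `|z - x|.
Proof.
move=> H x z xr zr.
have [|w wb ->] := @increment f x z.
  by move=> y /boxed_dist => /(_ _ _ xr zr) yr i; have [] := H _ yr i.
apply: le_trans (ler_norm_sum _ _ _) _.
have -> : n%:R * L * `|z - x| = \sum_(i < n) L * `|z - x|.
  by rewrite sumr_const card_ord -mulrA mulr_natl.
apply: ler_sum => i _; rewrite normrM mulrC; apply: ler_pM => //.
  by have [] := H _ (boxed_dist (wb i) xr zr) i.
exact: norm_coord.
Qed.

(** The candidate for the differential of [f] at [y], made a linear map so that it can be compared
    with ['d f y]. *)
Definition sum_partials f y (v : 'rV[R]_n) : R :=
  \sum_i v 0 i * 'D_(basis_row i) f y.

Lemma sum_partials_is_linear f y : linear (sum_partials f y : _ -> R^o).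
Proof.
move=> a u v; rewrite /sum_partials scaler_sumr -big_split /=.
by apply: eq_bigr => i _; rewrite !mxE mulrDl -mulrA.
Qed.

HB.instance Definition _ f y := GRing.isLinear.Build R 'rV[R]_n R^o _
  (sum_partials f y) (@sum_partials_is_linear f y).

Lemma sum_partials_continuous f y : continuous (sum_partials f y).
Proof.
move=> v; apply: (@cvg_sumR R _ (nbhs v)) => i _.
by apply: cvgM; [exact: coord_continuous | exact: cvg_cst].
Qed.

(** The points given by [increment] are no farther from [y] than the increment [v], so there each
    partial derivative differs from its value at [y] by at most [e'], and the total error is at most
    n e' |v|. *)
Lemma C1_differentiable f y :
  (forall i, \forall z \near y, derivable f z (basis_row i)) ->
  (forall i, {for y, continuous ('D_(basis_row i) f)}) ->
  differentiable f y /\ 'd f y = sum_partials f y :> ('rV[R]_n -> R).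
Proof.
move=> df cdf.
have E : f \o shift y = cst (f y) + sum_partials f y +o_ (0 : 'rV[R]_n) id.
  apply/eqaddoP => e e0.
  (* The summand 1 keeps the denominator positive in dimension 0. *)
  pose e' := e / (n%:R + 1).
  have e'0 : 0 < e' by rewrite divr_gt0 // ltr_wpDl.
  have near_df i : \forall z \near y, derivable f z (basis_row i) /\
      `|'D_(basis_row i) f z - 'D_(basis_row i) f y| <= e'.
    apply: filterI; first exact: df.
    have := cdf i => /cvgrPdist_le /(_ _ e'0).
    by apply: filterS => z; rewrite distrC.
  have := @filter_forall _ _ _ _ (nbhs_filter y) near_df.
  move=> /nbhs_ballP[r /= r0 H].
  apply/nbhs_ballP; exists r => //= v; rewrite -ball_normE /= sub0r normrN => vr.
  rewrite !fctE /=.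
  have [|w wb] := @increment f y (v + y).
    move=> z zb i; apply: (H _ _ i).1; rewrite -ball_normE /= distrC.
    apply: le_lt_trans vr; apply: (boxed_dist zb); rewrite ?subrr ?normr0 //.
    by rewrite addrK.
  rewrite opprD addrA => ->.
  rewrite /sum_partials addrK -sumrB.
  under eq_bigr do rewrite -mulrBr.
  apply: le_trans (ler_norm_sum _ _ _) _.
  apply: (@le_trans _ _ (\sum_(i < n) e' * `|v|)).
    apply: ler_sum => i _; rewrite normrM mulrC; apply: ler_pM => //.
      apply: (H _ _ i).2; rewrite -ball_normE /= distrC.
      apply: le_lt_trans vr; apply: (boxed_dist (wb i)); rewrite ?subrr ?normr0 //.
      by rewrite addrK.
    exact: norm_coord.
  rewrite sumr_const card_ord -mulr_natl mulrA ler_wpM2r //.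
  by rewrite /e' mulrCA ler_piMr ?(ltW e0) // ler_pdivrMr ?ltr_wpDl // mul1r lerDl.
have D : 'd f y = sum_partials f y :> (_ -> _).
  by apply: diff_unique => //; exact: sum_partials_continuous.
split=> //; apply/diff_locallyP; rewrite D; split => //.
exact: sum_partials_continuous.
Qed.

End Coordinates.

(** * Smooth functions on open sets *)

Section SmoothGeneral.
Context {R : realType} {n : nat} {V : normedModType R}.
Implicit Types (y : 'rV[R]_n) (U W : set 'rV[R]_n) (f g : 'rV[R]_n -> V) (s t : seq 'I_n).

Lemma iter_partial_cat s t f :
  iter_partial (s ++ t) f = iter_partial s (iter_partial t f).
Proof. exact: foldr_cat. Qed.

Lemma near_iter_partial s f g y : (\forall z \near y, f z = g z) ->
  \forall z \near y, iter_partial s f z = iter_partial s g z.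
Proof.
elim: s => //= i s IH /IH /nbhs_interior.
by apply: filterS => z; exact: near_eq_derive.
Qed.

Lemma near_open U (P : 'rV[R]_n -> Prop) y : open U -> U y ->
  (forall z, U z -> P z) -> \forall z \near y, P z.
Proof. by move=> oU Uy UP; apply: filterS UP _; exact: open_nbhs_nbhs. Qed.

(** Smoothness depends on germs only. This handles functions given by different formulas near
    different points, such as a bump extended by zero. *)
Lemma smooth_on_near U f :
  (forall y, U y -> exists g W,
    [/\ W y, smooth_on W g & \forall z \near y, f z = g z]) -> smooth_on U f.
Proof.
move=> H s y /H[g [W [Wy sg fg]]]; have [cg dg] := sg s y Wy.
have fgs := near_iter_partial s fg.
have gfs : \forall z \near y, iter_partial s g z = iter_partial s f z.
  by apply: filterS fgs => z ->.
split=> [|i]; last exact: near_eq_derivable gfs (dg i).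
rewrite /prop_for /continuous_at (nbhs_singleton fgs).
by apply: cvg_trans cg; exact: near_eq_cvg gfs.
Qed.

Lemma smooth_on_ext U f g : open U -> (forall y, U y -> f y = g y) ->
  smooth_on U g -> smooth_on U f.
Proof.
move=> oU fg sg; apply: smooth_on_near => y Uy.
by exists g, U; split => //; exact: near_open fg.
Qed.

Lemma smooth_on_iter U s f : smooth_on U f -> smooth_on U (iter_partial s f).
Proof. by move=> sf t y Uy; rewrite -iter_partial_cat; exact: sf. Qed.

Lemma smooth_on_partial U i f : smooth_on U f -> smooth_on U ('D_(basis_row i) f).
Proof. exact: (@smooth_on_iter U [:: i]). Qed.

Lemma smooth_on_continuous U f y : smooth_on U f -> U y -> {for y, continuous f}.
Proof. by move=> sf /(sf [::])[]. Qed.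

Lemma smooth_on_derivable U f y i : smooth_on U f -> U y ->
  derivable f y (basis_row i).
Proof. by move=> sf /(sf [::])[_]; exact. Qed.

Lemma iter_partialD U s f g : open U -> smooth_on U f -> smooth_on U g ->
  forall y, U y ->
  iter_partial s (f + g) y = iter_partial s f y + iter_partial s g y.
Proof.
move=> oU sf sg; elim: s => //= i s IH y Uy.
rewrite -deriveD; [|exact: (sf s y Uy).2|exact: (sg s y Uy).2].
by apply: near_eq_derive; exact: near_open IH.
Qed.

Lemma iter_partialZ U s (a : R) f : open U -> smooth_on U f ->
  forall y, U y -> iter_partial s (a *: f) y = a *: iter_partial s f y.
Proof.
move=> oU sf; elim: s => //= i s IH y Uy.
rewrite -deriveZ; last exact: (sf s y Uy).2.
by apply: near_eq_derive; exact: near_open IH.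
Qed.

Lemma iter_partialN U s f : open U -> smooth_on U f ->
  forall y, U y -> iter_partial s (- f) y = - iter_partial s f y.
Proof.
by move=> oU sf y Uy; rewrite -scaleN1r (iter_partialZ _ _ oU) // scaleN1r.
Qed.

Lemma smooth_onD U f g : open U -> smooth_on U f -> smooth_on U g ->
  smooth_on U (f + g).
Proof.
move=> oU sf sg s y Uy.
have E := iter_partialD s oU sf sg.
have [[cf df] [cg dg]] := (sf s y Uy, sg s y Uy).
have nE : \forall z \near y, (iter_partial s f + iter_partial s g) z = iter_partial s (f + g) z.
  by apply: near_open oU Uy _ => z /E ->.
split=> [|i]; last by apply: near_eq_derivable nE _; exact: derivableD.
rewrite /prop_for /continuous_at (E _ Uy).
apply: cvg_trans (cvgD cf cg).
exact: near_eq_cvg nE.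
Qed.

Lemma smooth_onZ U (a : R) f : open U -> smooth_on U f -> smooth_on U (a *: f).
Proof.
move=> oU sf s y Uy.
have E := iter_partialZ s a oU sf.
have [cf df] := sf s y Uy.
have nE : \forall z \near y, (a *: iter_partial s f) z = iter_partial s (a *: f) z.
  by apply: near_open oU Uy _ => z /E ->.
split=> [|i]; last by apply: near_eq_derivable nE _; exact: derivableZ.
rewrite /prop_for /continuous_at (E _ Uy).
apply: (cvg_trans (near_eq_cvg nE)).
exact: (cvgZl_tmp cf).
Qed.

Lemma smooth_onN U f : open U -> smooth_on U f -> smooth_on U (- f).
Proof. by move=> oU sf; rewrite -scaleN1r; exact: smooth_onZ. Qed.

Lemma iter_partial_cst s (a : V) : iter_partial s (cst a) = cst (if s is [::] then a else 0).
Proof.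
by elim: s => //= i s ->; apply/funext => y; rewrite derive_cst.
Qed.

Lemma smooth_on_cst U (a : V) : smooth_on U (cst a).
Proof.
move=> s y _; rewrite iter_partial_cst; split => [|i]; first exact: cst_continuous.
exact: derivable_cst.
Qed.

End SmoothGeneral.

Section SmoothCoord.
Context {R : realType} {n m : nat}.
Implicit Types (y : 'rV[R]_n) (U : set 'rV[R]_n) (T : 'rV[R]_n -> 'rV[R]_m).

Definition coordf T (k : 'I_m) : 'rV[R]_n -> R := fun y => T y 0 k.

Lemma iter_partial_coord U s T k : open U -> smooth_on U T ->
  forall y, U y -> iter_partial s (coordf T k) y = iter_partial s T y 0 k.
Proof.
move=> oU sT; elim: s => //= i s IH y Uy.
rewrite derive_mx; last exact: (sT s y Uy).2.
by rewrite mxE; apply: near_eq_derive; exact: near_open IH.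
Qed.

Lemma smooth_on_coord U T k : open U -> smooth_on U T -> smooth_on U (coordf T k).
Proof.
move=> oU sT s y Uy; have E := iter_partial_coord s k oU sT.
have [cT dT] := sT s y Uy.
have nE : \forall z \near y, coordf (iter_partial s T) k z = iter_partial s (coordf T k) z.
  by apply: near_open oU Uy _ => z /E ->.
split=> [|i]; last first.
  have /derivable_mxP dTi := dT i.
  exact: near_eq_derivable nE (dTi 0 k).
rewrite /prop_for /continuous_at (E _ Uy).
apply: (cvg_trans (near_eq_cvg nE)).
exact: (continuous_comp cT (@coord_continuous R 1 m 0 k _)).
Qed.

End SmoothCoord.

Section SmoothReal.
Context {R : realType} {n : nat}.
Implicit Types (y : 'rV[R]_n) (U : set 'rV[R]_n) (f g : 'rV[R]_n -> R).

(** The algebra of functions generated by [B]. Partial derivatives of members of [B] will only have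
    to lie in this algebra, not in [B] itself. *)
Inductive generated (B : set ('rV[R]_n -> R)) : ('rV[R]_n -> R) -> Prop :=
| gen_base f : B f -> generated B f
| gen_cst a : generated B (cst a)
| gen_add f g : generated B f -> generated B g -> generated B (f + g)
| gen_mul f g : generated B f -> generated B g -> generated B (f * g).

Lemma gen_sum B (I : Type) (r : seq I) (F : I -> 'rV[R]_n -> R) :
  (forall i, generated B (F i)) -> generated B (\sum_(i <- r) F i).
Proof.
move=> H; elim: r => [|i r IH]; first by rewrite big_nil; exact: gen_cst.
by rewrite big_cons; apply: gen_add.
Qed.

(* Reduces smoothness to first partial derivatives: no formula for the iterated
   derivatives of a product or a composite is ever needed. *)
Lemma smooth_generated U B : open U ->
  (forall f, B f -> forall y, U y -> {for y, continuous f}) ->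
  (forall f, B f -> forall i, exists2 g, generated B g &
    forall y, U y -> is_derive y (basis_row i) f (g y)) ->
  forall f, generated B f -> smooth_on U f.
Proof.
move=> oU cB dB.
have cG f : generated B f -> forall y, U y -> {for y, continuous f}.
  elim=> [{}f Bf|a|{}f g _ IHf _ IHg|{}f g _ IHf _ IHg] y Uy.
  - exact: cB.
  - exact: cst_continuous.
  - by apply: continuousD; [exact: IHf|exact: IHg].
  - by apply: continuousM; [exact: IHf|exact: IHg].
have dG f : generated B f -> forall i, exists2 g, generated B g &
    forall y, U y -> is_derive y (basis_row i) f (g y).
  elim=> [{}f Bf|a|{}f g gf IHf gg IHg|{}f g gf IHf gg IHg] i.
  - exact: dB.
  - by exists (cst 0) => [|y _]; [exact: gen_cst|exact: is_derive_cst].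
  - have [[f' gf' df] [g' gg' dg]] := (IHf i, IHg i).
    exists (f' + g') => [|y Uy]; first exact: gen_add.
    by have := df y Uy; have := dg y Uy => ? ?; exact: is_deriveD.
  - have [[f' gf' df] [g' gg' dg]] := (IHf i, IHg i).
    exists (f * g' + g * f') => [|y Uy]; first by apply: gen_add; exact: gen_mul.
    by have := df y Uy; have := dg y Uy => ? ?; exact: is_deriveM.
move=> f gf s.
have [g gg E] : exists2 g, generated B g & forall y, U y -> iter_partial s f y = g y.
  elim: s => [|i s [g gg E]]; first by exists f.
  have [g' gg' dg] := dG g gg i; exists g' => //= y Uy.
  rewrite (@near_eq_derive _ _ _ _ g); last exact: near_open E.
  by have [] := dg y Uy.
move=> y Uy; have nE : \forall z \near y, g z = iter_partial s f z.
  by apply: near_open oU Uy _ => z /E ->.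
split=> [|i].
  rewrite /prop_for /continuous_at (E _ Uy).
  by apply: (cvg_trans (near_eq_cvg nE)); exact: cG.
apply: near_eq_derivable nE _.
by have [g' _ dg] := dG g gg i; have [] := dg y Uy.
Qed.

Lemma smooth_on_is_derive U f y i : smooth_on U f -> U y ->
  is_derive y (basis_row i) f ('D_(basis_row i) f y).
Proof. by move=> sf Uy; split => //; exact: smooth_on_derivable sf Uy. Qed.

Lemma smooth_on_generated U f : open U ->
  generated (smooth_on U : set (_ -> _)) f -> smooth_on U f.
Proof.
move=> oU; apply: smooth_generated oU _ _ _ => {}f sf.
  by move=> y Uy; exact: smooth_on_continuous sf Uy.
move=> i; exists ('D_(basis_row i) f).
  by apply: gen_base; exact: smooth_on_partial.
by move=> y Uy; exact: smooth_on_is_derive sf Uy.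
Qed.

Lemma smooth_onM U f g : open U -> smooth_on U f -> smooth_on U g ->
  smooth_on U (f * g).
Proof.
by move=> oU sf sg; apply: smooth_on_generated => //; apply: gen_mul; exact: gen_base.
Qed.

Lemma smooth_on_sum U (I : Type) (r : seq I) (F : I -> 'rV[R]_n -> R) : open U ->
  (forall i, smooth_on U (F i)) -> smooth_on U (\sum_(i <- r) F i).
Proof.
by move=> oU sF; apply: smooth_on_generated => //; apply: gen_sum => i; exact: gen_base.
Qed.

Lemma smooth_on_rV_coord U i : open U -> smooth_on U (fun y : 'rV[R]_n => y 0 i).
Proof.
move=> oU; apply: (@smooth_generated U [set (fun y : 'rV[R]_n => y 0 i)] oU).
- by move=> _ -> y _; exact: coord_continuous.
- move=> _ -> j; exists (cst ((basis_row j) 0 i)); first exact: gen_cst.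
  move=> y _; split.
    apply: diff_derivable; exact: differentiable_coord.
  rewrite deriveE; last exact: differentiable_coord.
  have L : linear (fun y : 'rV[R]_n => y 0 i : R^o).
    by move=> a u v; rewrite !mxE.
  pose M := GRing.isLinear.Build _ _ _ _ (fun y : 'rV[R]_n => y 0 i : R^o) L.
  pose l : {linear 'rV[R]_n -> R^o} := HB.pack (fun y : 'rV[R]_n => y 0 i : R^o) M.
  by rewrite (@diff_lin _ _ _ l) //; exact: coord_continuous.
- exact: gen_base.
Qed.

Lemma smooth_on_diff U f y : open U -> smooth_on U f -> U y ->
  differentiable f y /\ 'd f y = sum_partials f y :> ('rV[R]_n -> R).
Proof.
move=> oU sf Uy; apply: C1_differentiable => i.
  by apply: near_open oU Uy _ => z; exact: smooth_on_derivable.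
exact: smooth_on_continuous (smooth_on_partial i sf) Uy.
Qed.

End SmoothReal.

Section Composition.
Context {R : realType} {n m : nat}.
Implicit Types (y : 'rV[R]_n) (U : set 'rV[R]_n) (T : 'rV[R]_n -> 'rV[R]_m).

Lemma smooth_on_differentiable U T y : open U -> smooth_on U T -> U y ->
  differentiable T y.
Proof.
move=> oU sT Uy.
have -> : T = \sum_(k < m) (fun z => coordf T k z *: basis_row k).
  by apply/funext => z; rewrite fct_sumE [LHS]coord_sum.
apply: differentiable_sum => k; apply: differentiableZl.
by have [] := smooth_on_diff oU (smooth_on_coord k oU sT) Uy.
Qed.

Lemma jacobianE U T y i k : open U -> smooth_on U T -> U y ->
  ('J T y) i k = 'D_(basis_row i) (coordf T k) y.
Proof.
move=> oU sT Uy.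
have /(congr1 (fun v : 'rV[R]_m => v 0 k)) := deriveEjacobian (basis_row i)
  (smooth_on_differentiable oU sT Uy).
rewrite -rowE mxE => <-.
have dT : derivable T y (basis_row i) by exact: smooth_on_derivable sT Uy.
by rewrite (derive_mx dT) mxE.
Qed.

Lemma is_derive_comp U (W : set 'rV[R]_m) T (f : 'rV[R]_m -> R) y i :
  open U -> open W -> smooth_on U T -> smooth_on W f -> U y -> W (T y) ->
  is_derive y (basis_row i) (f \o T)
    (\sum_k 'D_(basis_row k) f (T y) * 'D_(basis_row i) (coordf T k) y).
Proof.
move=> oU oW sT sf Uy Wy.
have dT := smooth_on_differentiable oU sT Uy.
have [df dfE] := smooth_on_diff oW sf Wy.
have dfT : differentiable (f \o T) y by exact: differentiable_comp.
split; first exact: diff_derivable.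
rewrite deriveE // diff_comp //= dfE -deriveE // /sum_partials.
apply: eq_bigr => k _; rewrite mulrC.
have dT' : derivable T y (basis_row i) by exact: diff_derivable.
by rewrite (derive_mx dT') mxE.
Qed.

(** The generators are the smooth functions on [U] and all composites g o T with [g] smooth on [W].
    By the chain rule a partial derivative of such a composite is a sum of products of
    generators. *)
Lemma smooth_on_comp U (W : set 'rV[R]_m) T (f : 'rV[R]_m -> R) :
  open U -> open W -> smooth_on U T -> smooth_on W f ->
  (forall y, U y -> W (T y)) -> smooth_on U (f \o T).
Proof.
move=> oU oW sT sf UW.
pose B : set ('rV[R]_n -> R) := smooth_on U `|` [set g \o T | g in smooth_on W].
apply: (@smooth_generated _ _ U B oU).
- move=> g [sg|[{}g sg <-]] y Uy; first exact: smooth_on_continuous sg Uy.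
  apply: continuous_comp; first exact: smooth_on_continuous sT Uy.
  exact: smooth_on_continuous sg (UW _ Uy).
- move=> g [sg|[{}g sg <-]] i.
    exists ('D_(basis_row i) g); last by move=> y; exact: smooth_on_is_derive.
    by apply: gen_base; left; exact: smooth_on_partial.
  exists (\sum_k (('D_(basis_row k) g) \o T) * 'D_(basis_row i) (coordf T k)).
    apply: gen_sum => k; apply: gen_mul; apply: gen_base; [right|left].
      by exists ('D_(basis_row k) g); first exact: smooth_on_partial.
    by apply: smooth_on_partial; exact: smooth_on_coord.
  move=> y Uy; rewrite fct_sumE.
  exact: (is_derive_comp _ oU oW sT sg Uy (UW _ Uy)).
- by apply: gen_base; right; exists f.
Qed.

End Composition.

(** * Bump functions *)

Section FlatFunctions.
Context {R : realType}.
Implicit Types (p : {poly R}) (t u : R).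

(* All derivatives of [t |-> exp(-1/t)], extended by [0], have this form. *)
Definition flat p t : R := if 0 < t then p.[t^-1] * expR (- t^-1) else 0.

(** For t > 0 the derivative of p(1/t) exp(-1/t) is t^-2 (p - p')(1/t) exp(-1/t), and t^-2 is the
    value of X^2 at 1/t. *)
Definition flat_deriv p : {poly R} := 'X ^+ 2 * (p - p^`()).

(** This is the inequality v <= exp v at v = u / (k+1), raised to the power k+1. *)
Lemma expr_expRN_le (k : nat) u : 0 < u ->
  u ^+ k * expR (- u) <= k.+1%:R ^+ k.+1 * u^-1.
Proof.
move=> u0; rewrite expRN ler_pdivrMr ?expR_gt0 // mulrAC ler_pdivlMr //.
rewrite -exprSr -[u in u ^+ _](@mulfVK _ (k.+1%:R)) ?pnatr_eq0 //.
rewrite exprMn mulrC ler_wpM2l ?exprn_ge0 //.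
rewrite -[in leRHS](@mulfVK _ k.+1%:R _ u) ?pnatr_eq0 // [in leRHS]mulrC expRM_natl.
rewrite lerXn2r ?nnegrE ?divr_ge0 ?(ltW u0) ?expR_ge0 //.
by apply: le_trans (expR_ge1Dx _); rewrite lerDr.
Qed.

Lemma poly_expRN_le p : exists2 C, 0 <= C &
  forall u, 0 < u -> `|p.[u]| * expR (- u) <= C * u^-1.
Proof.
exists (\sum_(i < size p) `|p`_i| * (i.+1%:R ^+ i.+1)).
  by apply: sumr_ge0 => i _; rewrite mulr_ge0 ?exprn_ge0.
move=> u u0; rewrite horner_coef.
apply: (@le_trans _ _ (\sum_(i < size p) `|p`_i| * (u ^+ i * expR (- u)))).
  under [leRHS]eq_bigr do rewrite mulrA.
  rewrite -mulr_suml ler_wpM2r ?expR_ge0 //.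
  apply: le_trans (ler_norm_sum _ _ _) _; apply: ler_sum => i _.
  by rewrite normrM [X in _ * X]ger0_norm ?exprn_ge0 // ltW.
rewrite mulr_suml; apply: ler_sum => i _; rewrite -mulrA ler_wpM2l //.
exact: expr_expRN_le.
Qed.

Lemma flat_is_derive p t : is_derive t 1 (flat p) (flat (flat_deriv p) t).
Proof.
have [t0|t0|->] := ltgtP t 0.
- have E : \forall z \near t, cst 0 z = flat p z.
    near=> z; rewrite /flat ltNge ltW //; near: z; exact: lt_nbhsl.
  apply: (near_eq_is_derive E).
  by rewrite /flat ltNge ltW //=; exact: is_derive_cst.
- pose g (z : R) := p.[z^-1] * expR (- z^-1).
  have E : \forall z \near t, g z = flat p z.
    near=> z; rewrite /flat ifT //; near: z; exact: lt_nbhsr.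
  apply: (near_eq_is_derive E).
  have tn0 : t != 0 by rewrite gt_eqF.
  have dV : is_derive t 1 (fun z : R => z^-1) (- t ^- 2).
    have := @is_deriveV R id t 1 1 tn0 (is_derive_id _ _).
    by rewrite [_ *: _]mulr1.
  have d1 : is_derive t 1 (fun z : R => p.[z^-1]) (- t ^- 2 * p^`().[t^-1]).
    have := @is_derive1_comp _ (horner p) (fun z : R => z^-1) t.
    move=> /(_ _ _ (is_derive_poly _ _) dV); rewrite mulrC; exact.
  have d2 : is_derive t 1 (fun z : R => expR (- z^-1)) (expR (- t^-1) * (t ^- 2)).
    have dN : is_derive t 1 (fun z : R => - z^-1) (t ^- 2).
      by have := is_deriveN dV; rewrite opprK.
    exact: (@is_derive1_comp _ expR (fun z : R => - z^-1) t _ _ (is_derive_expR _) dN).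
  have := is_deriveM d1 d2.
  rewrite /flat t0 /flat_deriv !hornerE => H; apply: is_derive_eq H _.
  rewrite /GRing.scale /= -exprVn. ring.
(* For h > 0 the difference quotient at 0 is (X p)(1/h) exp(-1/h), hence the factor ['X]; the bound
   C / (1/h) = C h then tends to 0. *)
- have [C C0 CP] := poly_expRN_le ('X * p).
  have F0 : flat (flat_deriv p) 0 = 0 by rewrite /flat ltxx.
  rewrite F0.
  have L : h^-1 *: ((flat p \o shift 0) (h *: (1:R)) - flat p 0) @[h --> (0:R)^'] --> (0:R).
    have bound (h : R) : `|h^-1 *: ((flat p \o shift 0) (h *: (1:R)) - flat p 0)| <= C * `|h|.
      rewrite /= addr0 [h *: 1]mulr1 /flat ltxx subr0 -[_ *: _]/(_ * _).
      case: ifP => [h0|_]; last by rewrite mulr0 normr0 mulr_ge0.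
      rewrite !normrM [`|expR _|]ger0_norm ?expR_ge0 // (gtr0_norm h0) mulrA -normrM.
      have := CP h^-1; rewrite invr_gt0 invrK !hornerE => /(_ h0).
      by rewrite normrM.
    apply/cvgr0Pnorm_le => e e0; near=> h.
    apply: le_trans (bound h) _.
    apply: (@le_trans _ _ ((C + 1) * `|h|)); first by rewrite ler_wpM2r ?lerDl.
    rewrite mulrC -ler_pdivlMr ?ltr_wpDl //.
    near: h; apply: dnbhs0_le; exact: divr_gt0 e0 (ltr_wpDl _ _).
  split; first by apply/cvg_ex; exists 0.
  by apply/cvg_lim.
Unshelve. all: by end_near. Qed.

End FlatFunctions.

Section ClosedBalls.
Context {R : realType} {n : nat}.

Lemma compact_closed_ball (y0 : 'rV[R]_n) (r : R) : 0 < r -> compact (closed_ball y0 r).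
Proof.
move=> r0; apply: bounded_closed_compact; last exact: closed_ball_closed.
rewrite closed_ballE //; exists (`|y0| + r); split; first exact: num_real.
move=> M ltM y /=; rewrite /closed_ball_ /= distrC => yr.
rewrite -[y](subrK y0) addrC (le_trans (ler_normD _ _)) // (le_trans _ (ltW ltM)) //.
by rewrite lerD2l.
Qed.

Lemma closed_ballP (y0 y : 'rV[R]_n) (r : R) : 0 < r ->
  closed_ball y0 r y <-> `|y - y0| <= r.
Proof. by move=> r0; rewrite closed_ballE // /closed_ball_ /= distrC. Qed.

End ClosedBalls.

Section Bump.
Context {R : realType} {n : nat}.
Implicit Types (U : set 'rV[R]_n) (f : 'rV[R]_n -> R).

(** All functions [flat q \o f] are taken as generators at once: differentiation only replaces [q]
    by [flat_deriv q]. *)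
Lemma smooth_on_flat U p f : open U -> smooth_on U f ->
  smooth_on U (flat p \o f).
Proof.
move=> oU sf.
pose B : set ('rV[R]_n -> R) := smooth_on U `|` range (fun q => flat q \o f).
have dflat q t : differentiable (flat q) t.
  by apply/derivable1_diffP; have [] := flat_is_derive q t.
apply: (@smooth_generated _ _ U B oU).
- move=> g [sg|[q _ <-]] y Uy; first exact: smooth_on_continuous sg Uy.
  apply: continuous_comp; first exact: smooth_on_continuous sf Uy.
  exact: differentiable_continuous.
- move=> g [sg|[q _ <-]] i.
    exists ('D_(basis_row i) g); last by move=> y; exact: smooth_on_is_derive.
    by apply: gen_base; left; exact: smooth_on_partial.
  exists ('D_(basis_row i) f * (flat (flat_deriv q) \o f)).
    apply: gen_mul; apply: gen_base; first by left; exact: smooth_on_partial.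
    by right; exists (flat_deriv q).
  move=> y Uy; have [df _] := smooth_on_diff oU sf Uy.
  split; first by apply: diff_derivable; exact: differentiable_comp.
  rewrite deriveE; last exact: differentiable_comp.
  rewrite diff_comp //= -[X in 'd (flat q) (f y) X = _]mulr1 [LHS]linearZ /=.
  rewrite -deriveE // -deriveE //; congr (_ * _).
  by have [] := flat_is_derive q (f y).
- by apply: gen_base; right; exists p.
Qed.

(** A smooth substitute for the maximum norm of y - y0. *)
Definition sqdist (y0 y : 'rV[R]_n) : R := \sum_i (y 0 i - y0 0 i) ^+ 2.

Lemma smooth_on_sqdist U y0 : open U -> smooth_on U (sqdist y0).
Proof.
move=> oU.
pose F (i : 'I_n) : 'rV[R]_n -> R :=
  ((fun y => y 0 i) + cst (- y0 0 i)) * ((fun y => y 0 i) + cst (- y0 0 i)).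
have E y : U y -> sqdist y0 y = (\sum_i F i) y.
  by move=> _; rewrite fct_sumE; apply: eq_bigr => i _; rewrite expr2.
apply: (smooth_on_ext oU E); apply: smooth_on_sum => // i; rewrite /F.
have s1 : smooth_on U ((fun y : 'rV[R]_n => y 0 i) + cst (- y0 0 i)).
  by apply: smooth_onD => //; [exact: smooth_on_rV_coord|exact: smooth_on_cst].
exact: smooth_onM.
Qed.

(** Let h(u) = exp(-1/u) for u > 0 and 0 otherwise. Then b = h(h(1) - h(1 - t)) / h(h(1)), where t =
    2 - 2 s / rho^2 and s is the squared distance to [y0]. It is 1 for t >= 1 and 0 for t <= 0;
    nesting h flattens both ends without dividing by a function. *)
Lemma exists_bump U (y0 : 'rV[R]_n) : open U -> U y0 ->
  exists b : 'rV[R]_n -> R, exists2 r : R, 0 < r &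
  exists C, [/\ smooth_on setT b, compact C, C `<=` U,
    forall y, `|y - y0| <= r -> C y /\ b y = 1 &
    forall y, ~ C y -> b y = 0].
Proof.
move=> oU Uy0.
have [rho rho0 rhoU] : exists2 rho : R, 0 < rho & closed_ball y0 rho `<=` U.
  have /nbhs_closedballP [r rU] : nbhs y0 U by exact: open_nbhs_nbhs.
  by exists r%:num.
pose t y := 2 - 2 / rho ^+ 2 * sqdist y0 y.
pose h := @flat R 1.
have h1 : 0 < h 1 by rewrite /h /flat ltr01 hornerE mul1r expR_gt0.
pose b y := (h (h 1))^-1 * h (h 1 - h (1 - t y)).
have st : smooth_on setT (fun y => 1 - t y).
  have -> : (fun y => 1 - t y) = cst (-1) + (2 / rho ^+ 2) *: sqdist y0.
    by apply/funext => y; rewrite /t !fctE /= /GRing.scale /=; ring.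
  apply: smooth_onD; [exact: openT|exact: smooth_on_cst|].
  apply: smooth_onZ; [exact: openT|]; exact: smooth_on_sqdist openT.
have sb : smooth_on setT b.
  have -> : b = (h (h 1))^-1 *: (h \o (cst (h 1) - (h \o (fun y => 1 - t y)))) by [].
  apply: smooth_onZ; first exact: openT.
  apply: smooth_on_flat; first exact: openT.
  apply: smooth_onD; [exact: openT|exact: smooth_on_cst|].
  apply: smooth_onN; first exact: openT.
  by apply: smooth_on_flat => //; exact: openT.
have hE (x : R) : x <= 0 -> h x = 0 by move=> x0; rewrite /h /flat ltNge x0.
have hmono (x : R) : 1 <= x -> h 1 <= h x.
  move=> x1; rewrite /h /flat ltr01 (lt_le_trans ltr01 x1) !hornerE ?mul1r.
  by rewrite ler_expR lerN2 invr1 invf_le1 // (lt_le_trans ltr01 x1).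
have rho2 : 0 < rho ^+ 2 by rewrite exprn_gt0.
(* [r] is a radius in the maximum norm: there s <= n r^2 <= rho^2 / 2, which means t >= 1. *)
pose r := rho / (2 * n.+1%:R).
have r0 : 0 < r by rewrite divr_gt0 // mulr_gt0.
exists b, r => //; exists (closed_ball y0 rho); split => //.
- exact: compact_closed_ball.
- move=> y yr; split.
    rewrite closed_ballE // /closed_ball_ /= distrC (le_trans yr) //.
    rewrite /r ler_pdivrMr ?mulr_gt0 // ler_peMr ?(ltW rho0) //.
    by rewrite -natrM ler1n muln_gt0.
  suff t1 : 1 <= t y by rewrite /b (hE (1 - t y)) ?subr_le0 // subr0 mulVf // gt_eqF // /h /flat h1 hornerE mul1r expR_gt0.
  have sq : sqdist y0 y <= rho ^+ 2 / 2.
    apply: (@le_trans _ _ (\sum_(i < n) r ^+ 2)).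
      apply: ler_sum => i _; rewrite -[leLHS]real_normK ?num_real // lerXn2r ?nnegrE ?(ltW r0) //.
      by apply: le_trans yr; have := norm_coord (y - y0) i; rewrite !mxE.
    rewrite sumr_const card_ord -[_ *+ n]mulr_natl /r expr_div_n mulrCA ler_wpM2l ?(ltW rho2) //.
    rewrite ler_pdivrMr ?exprn_gt0 ?mulr_gt0 //.
    have n0 : (0 : R) <= n%:R by [].
    rewrite -[n.+1%:R]natr1; set x := n%:R in n0 *.
    have -> : 2^-1 * (2 * (x + 1)) ^+ 2 = x + 2 + (2 * x ^+ 2 + 3 * x) by field.
    have := sqr_ge0 x; lra.
  rewrite /t lerBrDl -lerBrDr (_ : 2 - 1 = 1); last by ring.
  by rewrite -ler_pdivlMl ?divr_gt0 // mulr1 invf_div.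
- move=> y Cy; rewrite /b [h (h 1 - _)]hE ?mulr0 // subr_le0; apply: hmono.
  rewrite lerBrDr addrC -lerBrDr subrr /t subr_le0 -ler_pdivrMl ?divr_gt0 // invf_div divfK //.
  rewrite leNgt; apply/negP => lt; apply: Cy; rewrite closed_ballE // /closed_ball_ /= distrC.
  apply: norm_rV_le (ltW rho0) _ => i; rewrite !mxE.
  rewrite -(@ler_pXn2r _ 2) ?nnegrE ?(ltW rho0) // (le_trans _ (ltW lt)) //.
  rewrite real_normK ?num_real // /sqdist (bigD1 i) //= lerDl.
  by apply: sumr_ge0 => j _; rewrite sqr_ge0.
Qed.

End Bump.

(** * Sard's theorem in equal dimensions *)

Section Pigeonhole.

(** A lattice point [k] is recorded by its cell and by the residues mod [B] of all its coordinates
    except the one attached to the cell. Within a cell, the first hypothesis recovers these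
    coordinates from their residues and the second one recovers the last coordinate, so the record
    determines [k]. *)
Lemma cell_pigeonhole (n M M' B : nat) (Bgt0 : (0 < B)%N)
    (cell : {ffun 'I_n.+1 -> 'I_M'} -> {ffun 'I_n.+1 -> 'I_M}) :
  (forall k k', cell k = cell k' ->
    forall j, k j = k' j %[mod B] -> k j = k' j) ->
  (forall c, exists i, forall k k', cell k = c -> cell k' = c ->
    (forall j, j != i -> k j = k' j) -> k = k') ->
  (M' ^ n.+1 <= M ^ n.+1 * B ^ n)%N.
Proof.
move=> Hmod /choice[i Hi].
have modB (m : nat) : (m %% B < B)%N by rewrite ltn_mod.
pose phi k := (cell k, [ffun j : 'I_n => Ordinal (modB (k (lift (i (cell k)) j)))]).
have phi_inj : injective phi.
  move=> k k' [ckk' /ffunP E]; apply: (Hi (cell k)) => // j.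
  rewrite eq_sym => /unlift_some[j' -> _]; apply: Hmod => //.
  by have := E j'; rewrite !ffunE -ckk' => /(congr1 val).
by have := leq_card phi phi_inj; rewrite card_prod !card_ffun !card_ord.
Qed.

Lemma eq_mod_close (m m' B : nat) : m = m' %[mod B] -> (m < m' + B)%N ->
  (m' < m + B)%N -> m = m'.
Proof.
wlog mm' : m m' / (m <= m')%N.
  move=> H; case: (leqP m m') => [/H//|/ltnW mm' E h1 h2].
  by apply/esym; exact: H.
move=> E _ h; have : (B %| m' - m)%N by rewrite -eqn_mod_dvd // E.
have : (m' - m < B)%N by lia.
case d : (m' - m)%N => [|k] kB; first by lia.
by move=> /dvdn_leq; lia.
Qed.

Lemma exists_cell (R : realType) (M : nat) (d x : R) : (0 < M)%N ->
  0 <= x -> x <= M%:R * d -> exists k : 'I_M, k%:R * d <= x <= k.+1%:R * d.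
Proof.
elim: M => // M IH _ x0 xM; case: (leP x (M%:R * d)) => h.
  case: M IH h xM => [_|M /(_ isT x0) IH /IH[k Hk] _]; last by exists (widen_ord (leqnSn _) k).
  by rewrite mul0r => h xM; exists ord0 => /=; rewrite mul0r x0.
by exists ord_max => /=; rewrite (ltW h).
Qed.

Lemma exists_natmul_gt (R : realType) (x e : R) : 0 <= x -> 0 < e ->
  exists2 k : nat, (0 < k)%N & x < k%:R * e.
Proof.
move=> x0 e0; exists (Num.bound (x / e)).+1 => //.
rewrite -ltr_pdivrMr // (lt_le_trans (archi_boundP _)) ?divr_ge0 ?(ltW e0) //.
by rewrite ler_nat.
Qed.

End Pigeonhole.

Section CompactBounds.
Context {R : realType} {n : nat}.

Lemma compact_bound (K : set 'rV[R]_n) (f : 'rV[R]_n -> R) : compact K ->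
  (forall y, K y -> {for y, continuous f}) ->
  \forall M \near +oo, forall y, K y -> `|f y| <= M.
Proof.
move=> /compact_near_coveringP cK cf.
apply: (cK _ _ (fun M y => `|f y| <= M)) => y Ky.
have /cvg_norm cfy : f z @[z --> y] --> f y by exact: cf.
exists ([set z | `|f z| < `|f y| + 1], [set M | `|f y| + 1 <= M]).
  split; last by apply: nbhs_pinfty_ge; exact: num_real.
  by apply: (cvgr_lt _ cfy); rewrite ltrDl.
by move=> [z M] [/= /ltW]; exact: le_trans.
Qed.

End CompactBounds.

Section Sard.
Context {R : realType} {n : nat}.
Variables (U : set 'rV[R]_n.+1) (g : 'I_n.+1 -> 'rV[R]_n.+1 -> R).
Variables (y0 : 'rV[R]_n.+1) (r : R).
Hypotheses (oU : open U) (r0 : 0 < r) (KU : closed_ball y0 r `<=` U).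
Hypothesis sg : forall i, smooth_on U (g i).

Definition jacmx (y : 'rV[R]_n.+1) : 'M[R]_n.+1 :=
  \matrix_(i, j) 'D_(basis_row j) (g i) y.

Let KUP (y : 'rV[R]_n.+1) : `|y - y0| <= r -> U y.
Proof. by move=> yr; apply: KU; apply/closed_ballP. Qed.

Lemma sard_bounds : exists2 L : R, 0 < L & forall y z : 'rV[R]_n.+1,
  `|y - y0| <= r -> `|z - y0| <= r -> forall i,
  `|g i z - g i y| <= L * `|z - y| /\
  `|g i z - g i y - \sum_j (z - y) 0 j * 'D_(basis_row j) (g i) y|
    <= L * `|z - y| ^+ 2.
Proof.
have cK := @compact_closed_ball _ _ y0 _ r0.
have : \forall M \near +oo, forall i j k (y : 'rV[R]_n.+1), `|y - y0| <= r ->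
    `|'D_(basis_row j) (g i) y| <= M /\
    `|'D_(basis_row k) ('D_(basis_row j) (g i)) y| <= M.
  have H (f : _ -> R) : smooth_on U f -> \forall M \near +oo, forall y, `|y - y0| <= r -> `|f y| <= M.
    move=> sf; have B : \forall M \near +oo, forall y, closed_ball y0 r y -> `|f y| <= M.
      apply: compact_bound => // y Ky.
      by apply: (smooth_on_continuous sf); exact: KU.
    by apply: filterS B => M B y yr; apply: B; apply/closed_ballP.
  apply: filter_forall => i; apply: filter_forall => j; apply: filter_forall => k.
  have s1 := smooth_on_partial j (sg i).
  apply: filterS2 (H _ s1) (H _ (smooth_on_partial k s1)) => M h1 h2 y yr.
  by split; [exact: h1|exact: h2].
move=> H.
have [M [M0 HM]] : exists M : R, 0 < M /\ forall i j k (y : 'rV[R]_n.+1), `|y - y0| <= r ->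
    `|'D_(basis_row j) (g i) y| <= M /\
    `|'D_(basis_row k) ('D_(basis_row j) (g i)) y| <= M.
  have [M [M0 HM]] := @filter_ex _ _ (@proper_pinfty_nbhs R) _
    (@filterI _ _ (@proper_pinfty_nbhs R) _ _ (nbhs_pinfty_gt (num_real (0:R))) H).
  by exists M.
have n0 : (0 : R) < n.+1%:R by [].
(* The first summand bounds the quadratic error, the second is a Lipschitz constant; their sum
   serves both inequalities. *)
pose L := n.+1%:R * (n.+1%:R * M) + n.+1%:R * M.
exists L; first by rewrite addr_gt0 // !mulr_gt0.
have HD i y yr j := (HM i j 0 y yr).1.
move=> y z yr zr i; split.
  apply: (@le_trans _ _ (n.+1%:R * M * `|z - y|)); last first.
    by rewrite ler_wpM2r // lerDr !mulr_ge0 // ltW.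
  apply: (lipschitz_box _ yr zr) => w wr j; split; last exact: HD.
  exact: smooth_on_derivable (sg i) (KUP wr).
have lipD j (w : 'rV[R]_n.+1) : `|w - y0| <= r -> `|'D_(basis_row j) (g i) w - 'D_(basis_row j) (g i) y|
    <= n.+1%:R * M * `|w - y|.
  move=> wr; apply: (lipschitz_box (f := 'D_(basis_row j) (g i)) _ yr wr) => w' wr' k.
  split; last exact: (HM i j k _ wr').2.
  exact: (smooth_on_derivable (smooth_on_partial j (sg i)) (KUP wr')).
have [|w wb ->] := @increment R n.+1 (g i) y z.
  move=> w wb j; have wr := boxed_dist wb yr zr.
  exact: (smooth_on_derivable (sg i) (KUP wr)).
rewrite -sumrB; under eq_bigr do rewrite -mulrBr.
apply: le_trans (ler_norm_sum _ _ _) _.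
apply: (@le_trans _ _ (\sum_(j < n.+1) `|z - y| * (n.+1%:R * M * `|z - y|))); last first.
  rewrite sumr_const card_ord -[leLHS]mulr_natl.
  have -> : n.+1%:R * (`|z - y| * (n.+1%:R * M * `|z - y|)) =
    n.+1%:R * (n.+1%:R * M) * `|z - y| ^+ 2 by ring.
  by rewrite ler_wpM2r // lerDl !mulr_ge0 // ltW.
apply: ler_sum => j _; rewrite normrM; apply: ler_pM => //; first exact: norm_coord.
apply: le_trans (lipD j _ _) _; first exact: boxed_dist (wb j) yr zr.
rewrite ler_wpM2l ?mulr_ge0 ?(ltW M0) //.
by apply: (boxed_dist (wb j)); rewrite ?subrr ?normr0.
Qed.

(* At a critical point the increments of g stay close to a hyperplane, so all
   coordinates but one determine the remaining one up to a quadratic error. *)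
Lemma critical_slab (L : R) y : 0 < L -> `|y - y0| <= r ->
  (forall z, `|z - y0| <= r -> forall i,
    `|g i z - g i y - \sum_j (z - y) 0 j * 'D_(basis_row j) (g i) y|
      <= L * `|z - y| ^+ 2) ->
  \det (jacmx y) = 0 ->
  exists i, forall z z' (d : R), `|z - y0| <= r -> `|z' - y0| <= r ->
    `|z - y| <= d -> `|z' - y| <= d ->
    (forall j, j != i -> g j z = g j z') ->
    `|g i z - g i z'| <= 2 * n.+1%:R * L * d ^+ 2.
Proof.
move=> L0 yr HL /eqP/det0P[v v0 vJ].
(* [v] annihilates the Jacobian from the left, so the combination of the increments of the g_j with
   coefficients v_j has no linear part. Solving it for the coordinate where [v] is largest does not
   magnify the error. *)
have [i vi_max] : exists i, forall j, `|v 0 j| <= `|v 0 i|.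
  by case: (@arg_maxP _ _ _ (0 : 'I_n.+1) xpredT (fun j => `|v 0 j|)) => // i _ H; exists i => j; exact: H.
have vi0 : 0 < `|v 0 i|.
  rewrite normr_gt0; apply: contra v0 => /eqP vi0; apply/eqP/rowP => j; rewrite mxE.
  by apply/eqP; rewrite -normr_le0 (le_trans (vi_max j)) // vi0 normr0.
exists i => z z' d zr zr' zd zd' E.
have est w : `|w - y0| <= r -> `|w - y| <= d ->
    `|\sum_j v 0 j * (g j w - g j y)| <= n.+1%:R * L * d ^+ 2 * `|v 0 i|.
  move=> wr wd.
  have -> : \sum_j v 0 j * (g j w - g j y) = \sum_j v 0 j *
      (g j w - g j y - \sum_k (w - y) 0 k * 'D_(basis_row k) (g j) y).
    have Z : \sum_j v 0 j * (\sum_k (w - y) 0 k * 'D_(basis_row k) (g j) y) = 0.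
      under eq_bigr do rewrite mulr_sumr.
      rewrite exchange_big big1 //= => k _.
      have /(congr1 (fun u : 'rV[R]_n.+1 => u 0 k)) := vJ.
      rewrite !mxE => vJk.
      transitivity ((w - y) 0 k * \sum_j v 0 j * jacmx y j k); last by rewrite vJk mulr0.
      by rewrite mulr_sumr; apply: eq_bigr => j _; rewrite !mxE; ring.
    by under [RHS]eq_bigr do rewrite mulrBr; rewrite sumrB Z subr0.
  apply: le_trans (ler_norm_sum _ _ _) _.
  apply: (@le_trans _ _ (\sum_(j < n.+1) `|v 0 i| * (L * d ^+ 2))).
    apply: ler_sum => j _; rewrite normrM; apply: ler_pM => //.
    apply: le_trans (HL w wr j) _; rewrite ler_wpM2l ?(ltW L0) //.
    by rewrite lerXn2r ?nnegrE // (le_trans _ wd).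
  by rewrite sumr_const card_ord -mulr_natl; rewrite le_eqVlt; apply/orP; left; apply/eqP; ring.
have S : v 0 i * (g i z - g i z') =
    \sum_j v 0 j * (g j z - g j y) - \sum_j v 0 j * (g j z' - g j y).
  rewrite -sumrB (bigD1 i) //= big1 ?addr0; first by ring.
  by move=> j ji; rewrite E // subrr.
rewrite -(ler_pM2l vi0) -normrM S (le_trans (ler_normB _ _)) //.
by apply: le_trans (lerD (est z zr zd) (est z' zr' zd')) _; rewrite le_eqVlt; apply/orP; left; apply/eqP; ring.
Qed.

(** Otherwise each of the M'^(n+1) lattice values of spacing rho = e / M' has a critical preimage
    [y k]. Cut the cube of radius [r] into M^(n+1) cells of side d = 2 r / M. Within a cell the
    lattice coordinates differ by less than [B], so residues mod [B] determine them, and by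
    [critical_slab] all but one of them determine the remaining one. Counting gives t^(n+1) <= P^n
    t^n, contrary to t = P^n + 1. *)
Lemma sard (e : R) : 0 < e -> exists2 a : 'rV[R]_n.+1, `|a| <= e &
  forall y, `|y - y0| <= r -> (forall i, g i y = a 0 i) -> \det (jacmx y) != 0.
Proof.
move=> e0; apply: contrapT => nex.
have crit (a : 'rV[R]_n.+1) : `|a| <= e -> exists y, [/\ `|y - y0| <= r, forall i, g i y = a 0 i &
    \det (jacmx y) = 0].
  move=> ae; apply: contrapT => ny; apply: nex; exists a => // y yr gy.
  by apply/eqP => dy; apply: ny; exists y.
have [L L0 HL] := sard_bounds.
have n0 : (0 : R) < n.+1%:R by [].
(* [Q] makes the slab thinner than one lattice step [rho], and [P] keeps the variation of the g_i
   over a cell below [B] steps. *)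
have [|Q Q0 HQ] := @exists_natmul_gt R (2 * n.+1%:R * L * (2 * r) ^+ 2) e _ e0.
  by rewrite !mulr_ge0 ?exprn_ge0 ?mulr_ge0 // ltW.
have [|P P0 HP] := @exists_natmul_gt R (L * (2 * r)) e _ e0.
  by rewrite !mulr_ge0 // ltW.
(* With these sizes d^2 / rho and d / (B rho) do not depend on [t], which is therefore free to
   exceed P^n. *)
pose t := (P ^ n).+1; pose M := (Q * t)%N; pose M' := (M * t)%N; pose B := (P * t)%N.
pose d := 2 * r / M%:R; pose rho := e / M'%:R.
have t0 : (0 < t)%N by [].
have M0 : (0 < M)%N by rewrite muln_gt0 Q0.
have M'0 : (0 < M')%N by rewrite muln_gt0 M0.
have B0 : (0 < B)%N by rewrite muln_gt0 P0.
have rho0 : 0 < rho by rewrite divr_gt0 // ltr0n.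
have q0 : (0 : R) < Q%:R by rewrite ltr0n.
have s0 : (0 : R) < t%:R by rewrite ltr0n.
have ME : M%:R = Q%:R * t%:R :> R by rewrite natrM.
have M'E : M'%:R = Q%:R * t%:R * t%:R :> R by rewrite natrM ME.
have BE : B%:R = P%:R * t%:R :> R by rewrite natrM.
have [qn0 sn0] : Q%:R != 0 :> R /\ t%:R != 0 :> R by rewrite !gt_eqF.
have rho_slab : 2 * n.+1%:R * L * d ^+ 2 < rho.
  rewrite -subr_gt0 /rho /d ME M'E.
  have -> : e / (Q%:R * t%:R * t%:R) - 2 * n.+1%:R * L * (2 * r / (Q%:R * t%:R)) ^+ 2
    = (Q%:R * e - 2 * n.+1%:R * L * (2 * r) ^+ 2) / (Q%:R * t%:R) ^+ 2.
    by field; rewrite qn0 sn0.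
  by rewrite divr_gt0 ?subr_gt0 // exprn_gt0 // mulr_gt0.
have rho_lip : L * d < B%:R * rho.
  rewrite -subr_gt0 /rho /d ME M'E BE.
  have -> : P%:R * t%:R * (e / (Q%:R * t%:R * t%:R)) - L * (2 * r / (Q%:R * t%:R))
    = (P%:R * e - L * (2 * r)) / (Q%:R * t%:R).
    by field; rewrite qn0 sn0.
  by rewrite divr_gt0 ?subr_gt0 // mulr_gt0.
have d0 : 0 <= d by rewrite divr_ge0 // mulr_ge0 // ltW.
pose latt (k : {ffun 'I_n.+1 -> 'I_M'}) : 'rV[R]_n.+1 := \row_i ((k i)%:R * rho).
have latt_e k : `|latt k| <= e.
  apply: (norm_rV_le (ltW e0)) => i.
  rewrite mxE ger0_norm; last exact: mulr_ge0 (ler0n _ _) (ltW rho0).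
  rewrite (_ : e = M'%:R * rho); last by rewrite /rho mulrC divfK // pnatr_eq0 -lt0n.
  by rewrite ler_wpM2r ?(ltW rho0) // ler_nat ltnW.
have critk k : exists y, [/\ `|y - y0| <= r, forall i, g i y = latt k 0 i &
    \det (jacmx y) = 0] by apply: crit; exact: latt_e.
have [y yP] := choice critk.
have [cell cellP] : exists cell : {ffun 'I_n.+1 -> 'I_M'} -> {ffun 'I_n.+1 -> 'I_M},
    forall k k', cell k = cell k' -> `|y k - y k'| <= d.
  have cellk k (j : 'I_n.+1) : exists c : 'I_M,
      c%:R * d <= (y k - y0) 0 j + r <= c.+1%:R * d.
    have [yr _ _] := yP k; have := le_trans (norm_coord (y k - y0) j) yr.
    rewrite ler_norml => /andP[h1 h2]; apply: exists_cell => //; first by lra.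
    by rewrite /d mulrC divfK; [lra|rewrite pnatr_eq0 -lt0n].
  have cellk' k : exists f : 'I_n.+1 -> 'I_M, forall j,
      (f j)%:R * d <= (y k - y0) 0 j + r <= (f j).+1%:R * d.
    by have [f fP] := choice (cellk k); exists f.
  have [c cP] := choice cellk'.
  exists (fun k => [ffun j => c k j]) => k k' /ffunP E.
  apply: norm_rV_le => // j.
  have := cP k j; have := cP k' j; have := E j; rewrite !ffunE => ->.
  rewrite -natr1 mulrDl mul1r !mxE => /andP[? ?] /andP[? ?].
  by rewrite ler_norml; apply/andP; split; lra.
have g_inj k k' (i : 'I_n.+1) (x : R) : `|g i (y k) - g i (y k')| <= x ->
    `|(k i)%:R - (k' i)%:R| * rho <= x.
  have [_ -> _] := yP k; have [_ -> _] := yP k'.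
  by rewrite !mxE -mulrBl normrM (gtr0_norm rho0).
have close (k k' : {ffun 'I_n.+1 -> 'I_M'}) (i : 'I_n.+1) (b : nat) : `|(k i)%:R - (k' i)%:R| * rho < b%:R * rho ->
    (k i < k' i + b)%N /\
    (k' i < k i + b)%N.
  rewrite ltr_pM2r // ltr_norml => /andP[h1 h2].
  by rewrite -!(ltr_nat R) !natrD; split; lra.
have Hmod k k' : cell k = cell k' -> forall j, k j = k' j %[mod B] -> k j = k' j.
  move=> ckk' j kk'B.
  have [[yr _ _] [yr' _ _]] := (yP k, yP k').
  have /close[h1 h2] : `|(k j)%:R - (k' j)%:R| * rho < B%:R * rho.
    apply: le_lt_trans rho_lip; apply: g_inj.
    apply: le_trans (HL _ _ yr' yr j).1 _; rewrite ler_wpM2l ?(ltW L0) //.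
    exact: cellP.
  exact/val_inj/(eq_mod_close kk'B).
have Hslab c : exists i, forall k k', cell k = c -> cell k' = c ->
    (forall j, j != i -> k j = k' j) -> k = k'.
  have [[k0 ck0]|nk] := pselect (exists k0, cell k0 = c); last first.
    by exists 0 => k k' ck; exfalso; apply: nk; exists k.
  have [yr0 _ dy0] := yP k0.
  have [|i Hi] := critical_slab L0 yr0 _ dy0; first by move=> z zr i; have [] := HL _ _ yr0 zr i.
  exists i => k k' ck ck' E; apply/ffunP => j.
  have [->|/E //] := eqVneq j i; apply: val_inj.
  have [yr gy _] := yP k; have [yr' gy' _] := yP k'.
  have H : `|(k i)%:R - (k' i)%:R| * rho <= 2 * n.+1%:R * L * d ^+ 2.
    apply: g_inj; apply: Hi => //; try by apply: cellP; rewrite ?ck ?ck' ck0.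
    by move=> l /E kl; rewrite gy gy' !mxE kl.
  have := @close k k' i 1; rewrite mul1r !addn1 !ltnS => /(_ (le_lt_trans H rho_slab))[h1 h2].
  by apply/eqP; rewrite eqn_leq h1.
have := cell_pigeonhole B0 Hmod Hslab.
rewrite /M' /B !expnMn leq_pmul2l ?expn_gt0 ?M0 // ?[(t ^ n.+1)%N]expnS ?leq_pmul2r ?muln_gt0 ?expn_gt0 ?Q0 //.
by rewrite ltnn.
Qed.

End Sard.

(** * Charts and their transition maps *)

Section LocalRep.
Context {R : realType} {n : nat} {M : Type}.
Implicit Types (c : chart R n M).

Definition chart_img c : set 'rV[R]_n := chart_map c @` chart_dom c.

Lemma local_repE (V : zmodType) c (f : M -> V) x :
  {in chart_dom c &, injective (chart_map c)} -> chart_dom c x ->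
  local_rep c f (chart_map c x) = f x.
Proof.
move=> ic cx; apply: xget_unique; first by exists x.
move=> _ [x' [cx' /= E] <-]; congr f.
by apply: ic; rewrite ?inE.
Qed.

Lemma local_rep_out (V : zmodType) c (f : M -> V) y :
  ~ chart_img c y -> local_rep c f y = 0.
Proof.
move=> ny; apply: xgetPN => _ [x [cx /= E] _]; apply: ny.
by exists x.
Qed.

End LocalRep.

Lemma partial_coordE (R : realType) n (y : 'rV[R]_n) i k :
  'D_(basis_row i) (fun z : 'rV[R]_n => z 0 k) y = (i == k)%:R.
Proof.
have := derive_mx (@derivable_id R 'rV[R]_n y (basis_row i)).
rewrite derive_id => /(congr1 (fun v : 'rV[R]_n => v 0 k)).
by rewrite basis_rowE mxE => ->.
Qed.

(* A sealed copy of the Jacobian matrix, which keeps unification from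
   unfolding derivatives. *)
Definition partials (R : realType) n m (T : 'rV[R]_n -> 'rV[R]_m) y : 'M[R]_(n, m) :=
  \matrix_(i, k) 'D_(basis_row i) (coordf T k) y.

Lemma partialsE (R : realType) n m (T : 'rV[R]_n -> 'rV[R]_m) y i k :
  partials T y i k = 'D_(basis_row i) (coordf T k) y.
Proof. by rewrite mxE. Qed.

Lemma jacobian_partials (R : realType) n m U (T : 'rV[R]_n -> 'rV[R]_m) y :
  open U -> smooth_on U T -> U y -> 'J T y = partials T y.
Proof.
by move=> oU sT Uy; apply/matrixP => i k; rewrite partialsE (jacobianE _ _ oU sT Uy).
Qed.

Opaque partials.

Section Charts.
Context {R : realType} {n : nat} {N : topologicalType} {A : set (chart R n N)}.
Hypothesis mA : smooth_manifold A.
Implicit Types (c : chart R n N) (x : N).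

Lemma chart_inj c : A c -> {in chart_dom c &, injective (chart_map c)}.
Proof. by case: mA => _ _ H _ _ /H[]. Qed.

Lemma chart_dom_open c : A c -> open (chart_dom c).
Proof. by case: mA => _ _ H _ _ /H[]. Qed.

Lemma chart_img_open c : A c -> open (chart_img c).
Proof. by case: mA => _ _ H _ _ /H[oc _ _]; apply. Qed.

Lemma chart_exists x : exists2 c, A c & chart_dom c x.
Proof. by case: mA. Qed.

Lemma chart_near c x (P : 'rV[R]_n -> Prop) : A c -> chart_dom c x ->
  (\forall y \near chart_map c x, P y) ->
  \forall x' \near x, chart_dom c x' /\ P (chart_map c x').
Proof.
move=> Ac cx Py; case: mA => _ _ /(_ _ Ac)[oc _ cc _] _ _.
apply: filterI; first exact: open_nbhs_nbhs.
by have := cc x; rewrite inE => /(_ cx); apply.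
Qed.

Lemma chart_inv_near c x (P : N -> Prop) : A c -> chart_dom c x ->
  (\forall x' \near x, P x') ->
  \forall y \near chart_map c x, exists x', [/\ chart_dom c x', chart_map c x' = y & P x'].
Proof.
move=> Ac cx; case: mA => _ _ /(_ _ Ac)[oc _ _ op] _ _.
move=> nP; have : nbhs x P := nP; rewrite nbhsE => -[W [oW Wx] WP].
have oV : open (chart_map c @` (W `&` chart_dom c)).
  by apply: op; [exact: openI|move=> ? []].
suff : nbhs (chart_map c x) [set y | exists x', [/\ chart_dom c x', chart_map c x' = y & P x']] by [].
rewrite nbhsE; exists (chart_map c @` (W `&` chart_dom c)).
  by split => //; exists x.
by move=> _ [x' [Wx' cx'] <-]; exists x'; split => //; exact: WP.
Qed.

Definition overlap c c' : set 'rV[R]_n :=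
  chart_map c @` (chart_dom c `&` chart_dom c').

Lemma overlap_open c c' : A c -> A c' -> open (overlap c c').
Proof.
move=> Ac Ac'; case: mA => _ _ H _ _; have [oc _ _ op] := H _ Ac.
by apply: op => [|? []//]; apply: openI => //; exact: chart_dom_open.
Qed.

Lemma transition_smooth c c' : A c -> A c' ->
  smooth_on (overlap c c') (transition c c').
Proof. by case: mA => _ _ _ _; exact. Qed.

Lemma transitionE c c' x : A c -> chart_dom c x ->
  transition c c' (chart_map c x) = chart_map c' x.
Proof. by move=> Ac cx; apply: local_repE => //; exact: chart_inj. Qed.

Definition tjac c c' x : 'M[R]_n := partials (transition c c') (chart_map c x).

Lemma tjacJ c c' x : A c -> A c' -> chart_dom c x -> chart_dom c' x ->
  'J (transition c c') (chart_map c x) = tjac c c' x.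
Proof.
move=> Ac Ac' cx c'x; apply: (@jacobian_partials _ _ _ (overlap c c')).
- exact: overlap_open.
- exact: transition_smooth.
- by exists x.
Qed.

Lemma tjacE c c' x i k :
  tjac c c' x i k = 'D_(basis_row i) (coordf (transition c c') k) (chart_map c x).
Proof. exact: partialsE. Qed.

Opaque tjac.

(** The chain rule. Tangent vectors are rows, so the matrix of the map applied first stands on the
    left. *)
Lemma tjac_comp c c' c'' x : A c -> A c' -> A c'' ->
  chart_dom c x -> chart_dom c' x -> chart_dom c'' x ->
  tjac c c'' x = tjac c c' x *m tjac c' c'' x.
Proof.
move=> Ac Ac' Ac'' cx c'x c''x; apply/matrixP => i k; rewrite tjacE mxE.
have E : \forall y \near chart_map c x,
    (coordf (transition c' c'') k \o transition c c') y = coordf (transition c c'') k y.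
  have : \forall x' \near x, chart_dom c x' /\ chart_dom c' x' /\ chart_dom c'' x'.
    by do ?apply: filterI; apply: open_nbhs_nbhs; split => //; exact: chart_dom_open.
  move=> /(chart_inv_near Ac cx); apply: filterS => y [x' [_ <- [cx' [c'x' c''x']]]].
  by rewrite /coordf /= !transitionE.
rewrite -(near_eq_derive _ E).
have D := @is_derive_comp _ _ _ (overlap c c') (overlap c' c'') (transition c c')
  (coordf (transition c' c'') k) (chart_map c x) i.
have [] := D.
- exact: overlap_open.
- exact: overlap_open.
- exact: transition_smooth.
- by apply: smooth_on_coord; [exact: overlap_open|exact: transition_smooth].
- by exists x.
- by rewrite transitionE //; exists x.
move=> _ ->; rewrite transitionE //.
by apply: eq_bigr => l _; rewrite mulrC tjacE tjacE.
Qed.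

Lemma tjac_id c x : A c -> chart_dom c x -> tjac c c x = 1%:M.
Proof.
move=> Ac cx; apply/matrixP => i k; rewrite tjacE mxE.
rewrite -(partial_coordE (chart_map c x)); apply: near_eq_derive.
have : \forall x' \near x, chart_dom c x'.
  by apply: open_nbhs_nbhs; split => //; exact: chart_dom_open.
move=> /(chart_inv_near Ac cx); apply: filterS => y [x' [_ <- cx']].
by rewrite /coordf transitionE.
Qed.

Lemma tjacK c c' x : A c -> A c' -> chart_dom c x -> chart_dom c' x ->
  tjac c c' x *m tjac c' c x = 1%:M.
Proof. by move=> *; rewrite -tjac_comp // tjac_id. Qed.

Lemma tjac_unit c c' x : A c -> A c' -> chart_dom c x -> chart_dom c' x ->
  tjac c c' x \in unitmx.
Proof.
by move=> Ac Ac' cx c'x; exact: (mulmx1_unit (tjacK Ac Ac' cx c'x)).1.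
Qed.

(** The determinant is continuous and nonzero on the overlap, so its sign is locally constant. *)
Lemma det_tjac_near c c' x : A c -> A c' -> chart_dom c x -> chart_dom c' x ->
  \forall x' \near x, [/\ chart_dom c x', chart_dom c' x' &
    (0 < \det (tjac c c' x')) = (0 < \det (tjac c c' x))].
Proof.
move=> Ac Ac' cx c'x.
have oW := overlap_open Ac Ac'; have sT := transition_smooth Ac Ac'.
have Wx : overlap c c' (chart_map c x) by exists x.
have Jcont : \det (partials (transition c c') y) @[y --> chart_map c x] -->
    \det (tjac c c' x).
  apply: (@cvg_det R _ (nbhs (chart_map c x)) _ n (fun y => partials (transition c c') y)
    (tjac c c' x)) => i j.
  rewrite tjacE; under eq_cvg do rewrite partialsE.
  exact: smooth_on_continuous (smooth_on_partial i (smooth_on_coord j oW sT)) Wx.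
have d0 : \det (tjac c c' x) != 0 by rewrite -unitfE -/(_ \is a GRing.unit) -unitmxE tjac_unit.
have : \forall y \near chart_map c x,
    (0 < \det (partials (transition c c') y)) = (0 < \det (tjac c c' x)).
  have [dn|dp|/eqP] := ltgtP (\det (tjac c c' x)) 0; last by rewrite (negbTE d0).
    have lt0 : \forall y \near chart_map c x, \det (partials (transition c c') y) < 0.
      exact: cvgr_lt _ Jcont _ dn.
    by apply: filterS lt0 => y yn; rewrite ltNge (ltW yn).
  have gt0 : \forall y \near chart_map c x, 0 < \det (partials (transition c c') y).
    exact: cvgr_gt _ Jcont _ dp.
  by apply: filterS gt0 => y ->.
move=> /(chart_near Ac cx) near_c.
have near_c' : \forall x' \near x, chart_dom c' x'.
  by apply: open_nbhs_nbhs; split => //; exact: chart_dom_open.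
by apply: filterS2 near_c near_c' => x' [].
Qed.

End Charts.

(** * Orientations *)

Section Orientations.
Context {R : realType} {n : nat} {N : topologicalType} {A : set (chart R n N)}.
Hypothesis mA : smooth_manifold A.
Implicit Types (c : chart R n N) (x : N).

Lemma tangent_transition c c' x v : chart_at A x c -> chart_at A x c' ->
  tangent_space A x v -> v c' = v c *m tjac c c' x.
Proof.
move=> [Ac cx] [Ac' c'x] [_ H].
by rewrite (H _ _ (conj Ac cx) (conj Ac' c'x)) (tjacJ mA).
Qed.

Lemma tangent_eq c x v w : chart_at A x c ->
  tangent_space A x v -> tangent_space A x w -> v c = w c -> v = w.
Proof.
move=> cx tv tw E; apply/funext => c'.
have [c'x|c'x] := pselect (chart_at A x c').
  by rewrite (tangent_transition cx c'x tv) (tangent_transition cx c'x tw) E.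
by rewrite tv.1 // tw.1.
Qed.

Lemma tangent_sum x (r : 'I_n -> R) (v : 'I_n -> chart R n N -> 'rV[R]_n) :
  (forall i, tangent_space A x (v i)) -> tangent_space A x (\sum_i r i *: v i).
Proof.
move=> tv; split=> [c ncx|c c' cx c'x].
  by rewrite fct_sumE big1 // => i _; rewrite scalrfctE (tv i).1 // scaler0.
rewrite !fct_sumE mulmx_suml; apply: eq_bigr => i _.
by rewrite !scalrfctE ((tv i).2 c c') // scalemxAl.
Qed.

(** The coordinate vector d/dx_i of [c] at [x], as a family indexed by all charts; it is 0 away from
    the charts at [x], as [tangent_space] demands. *)
Definition coord_vec c x (i : 'I_n) : chart R n N -> 'rV[R]_n := fun c' =>
  if pselect (chart_at A x c') then row i (tjac c c' x) else 0.

Lemma coord_vecE c c' x i : chart_at A x c' ->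
  coord_vec c x i c' = row i (tjac c c' x).
Proof. by rewrite /coord_vec; case: pselect. Qed.

Lemma coord_vec_tangent c x i : chart_at A x c ->
  tangent_space A x (coord_vec c x i).
Proof.
move=> [Ac cx]; split=> [c' nc'|c' c'' c'x c''x]; first by rewrite /coord_vec; case: pselect.
rewrite !coord_vecE // (tjacJ mA); [|exact: c'x.1|exact: c''x.1|exact: c'x.2|exact: c''x.2].
by rewrite -row_mul -(tjac_comp mA) //; [exact: c'x.1|exact: c''x.1|exact: c'x.2|exact: c''x.2].
Qed.

Lemma coord_vec_free c x (a : 'I_n -> R) : chart_at A x c ->
  \sum_i a i *: coord_vec c x i = 0 -> forall i, a i = 0.
Proof.
move=> cx /(congr1 (fun v => v c)); rewrite fct_sumE => E i.
have {}E : \sum_i a i *: basis_row i = 0 :> 'rV[R]_n.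
  rewrite -[RHS]E; apply: eq_bigr => j _ /=.
  by rewrite scalrfctE coord_vecE // (tjac_id mA cx.1 cx.2) row1.
have /(congr1 (fun v : 'rV[R]_n => v 0 i)) := E.
rewrite summxE mxE (bigD1 i) //= big1 => [|j ji].
  by rewrite !mxE !eqxx mulr1 addr0.
by rewrite !mxE eqxx /= eq_sym (negbTE ji) mulr0.
Qed.

Definition coord_basis c x (cx : chart_at A x c) : tangent_basis A x :=
  TangentBasis (fun i => coord_vec_tangent i cx) (fun a => @coord_vec_free c x a cx).

Definition basis_mx c x (b : tangent_basis A x) : 'M[R]_n := \matrix_i b i c.

Lemma basis_mx_unit c x (b : tangent_basis A x) : chart_at A x c ->
  basis_mx c b \in unitmx.
Proof.
move=> cx; rewrite unitmxE unitfE; apply/negP => /det0P[v v0 vb].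
case/negP: v0; apply/eqP/rowP => i; rewrite mxE.
apply: (@Defs.basis_free _ _ _ _ _ b (fun i => v 0 i)).
apply: (@tangent_eq c x) => //; first by apply: tangent_sum => j; exact: basis_tangent.
  by split=> // *; rewrite mul0mx.
rewrite fct_sumE -[RHS]vb mulmx_sum_row.
by apply: eq_bigr => j _; rewrite scalrfctE rowK.
Qed.

(** Coordinates in [c] turn the change of bases into [basis_mx c b'] times the inverse of
    [basis_mx c b], whose determinant has the sign of the product. *)
Lemma same_orientationE c x (b b' : tangent_basis A x) : chart_at A x c ->
  same_orientation b b' <-> 0 < \det (basis_mx c b) * \det (basis_mx c b').
Proof.
move=> cx; have ub := basis_mx_unit b cx.
have db : \det (basis_mx c b) != 0 by rewrite unitmxE unitfE in ub.
have mxP (P : 'M[R]_n) : (forall i, b' i = \sum_j P i j *: b j) <->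
    basis_mx c b' = P *m basis_mx c b.
  split=> [H|H i].
    apply/row_matrixP => i; rewrite row_mul rowK H fct_sumE mulmx_sum_row.
    by apply: eq_bigr => j _; rewrite scalrfctE rowK mxE.
  apply: (@tangent_eq c x) => //; first exact: basis_tangent.
    by apply: tangent_sum => j; exact: basis_tangent.
  have := congr1 (row i) H; rewrite rowK row_mul mulmx_sum_row => ->.
  by rewrite fct_sumE; apply: eq_bigr => j _; rewrite rowK mxE.
split=> [[P P0 /mxP ->]|H].
  by rewrite det_mulmx mulrCA pmulr_rgt0 // -expr2 exprn_even_gt0.
exists (basis_mx c b' *m invmx (basis_mx c b)); last first.
  by apply/mxP; rewrite mulmxKV.
rewrite det_mulmx det_inv.
have -> : \det (basis_mx c b') / \det (basis_mx c b) =
    \det (basis_mx c b) * \det (basis_mx c b') / \det (basis_mx c b) ^+ 2 by field.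
by rewrite divr_gt0 // exprn_even_gt0.
Qed.

Lemma basis_mx_coord c c' x (cx : chart_at A x c) : chart_at A x c' ->
  basis_mx c' (coord_basis cx) = tjac c c' x.
Proof. by move=> c'x; apply/row_matrixP => i; rewrite rowK /= coord_vecE. Qed.

Lemma det_basis_mx_coord c x (cx : chart_at A x c) :
  \det (basis_mx c (coord_basis cx)) = 1.
Proof. by rewrite basis_mx_coord // (tjac_id mA cx.1 cx.2) det1. Qed.

Lemma tangent_basis_eq x (b b' : tangent_basis A x) :
  (forall i, b i = b' i) -> b = b'.
Proof.
case: b b' => [v t f] [v' t' f'] /= /funext E; subst v'.
by congr TangentBasis; exact: Prop_irrelevance.
Qed.

(** A tangent basis is determined by its coordinates in [c], so the existential in [chart_positive]
    amounts to the membership of one explicit basis. *)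
Lemma chart_positiveE c x (cx : chart_at A x c) (O : orientation A x) :
  chart_positive c O <-> positive_basis O (coord_basis cx).
Proof.
have e i : row i (tjac c c x) = delta_mx 0 i.
  by rewrite (tjac_id mA cx.1 cx.2) row1.
split=> [[b Ob E]|Ob].
  suff <- : b = coord_basis cx by [].
  apply: tangent_basis_eq => i; apply: (@tangent_eq c x) => //; try exact: basis_tangent.
  by rewrite E /= coord_vecE.
by exists (coord_basis cx) => // i; rewrite /= coord_vecE.
Qed.

Lemma chart_positive_transition c c' x (O : orientation A x) :
  chart_at A x c -> chart_at A x c' ->
  (chart_positive c O <-> chart_positive c' O) <-> 0 < \det (tjac c c' x).
Proof.
move=> cx c'x; rewrite (chart_positiveE cx) (chart_positiveE c'x) -(orientationP O).
by rewrite (same_orientationE _ _ c'x) basis_mx_coord // det_basis_mx_coord mulr1.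
Qed.

Lemma chart_positive_opp c x (O : orientation A x) : chart_at A x c ->
  chart_positive c (opp_orientation O) <-> ~ chart_positive c O.
Proof. by move=> cx; rewrite !(chart_positiveE cx). Qed.

Lemma orientation_eq c x (O O' : orientation A x) : chart_at A x c ->
  (chart_positive c O <-> chart_positive c O') -> O = O'.
Proof.
move=> cx; rewrite !(chart_positiveE cx) => E.
have P b : positive_basis O b <-> positive_basis O' b.
  have := orientationP O (coord_basis cx) b; have := orientationP O' (coord_basis cx) b.
  by case: (pselect (positive_basis O b)); case: (pselect (positive_basis O' b)); tauto.
have {}P : positive_basis O = positive_basis O' by apply/seteqP; split => b /P.
case: O O' P {E} => [p pP] [p' p'P] /= E; subst p'.
by congr Orientation; exact: Prop_irrelevance.
Qed.

Lemma gt0_mulr_iff (a b : R) : a != 0 -> b != 0 ->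
  0 < a * b <-> (0 < a <-> 0 < b).
Proof.
have T : true by []; have F : ~ false by [].
case: (ltgtP a 0) => // a0 _; rewrite ?(nmulr_rgt0 _ a0) ?(pmulr_rgt0 _ a0);
  by case: (ltgtP b 0) => // _ _; tauto.
Qed.

(** The bases with positive determinant in [c] form one orientation, their complement the other. In
    dimension 0 the determinant is 1, and the two are the full and the empty set of bases. *)
Lemma chart_orientation c x (s : bool) : chart_at A x c ->
  exists O : orientation A x, chart_positive c O <-> s.
Proof.
move=> cx.
have d0 (b : tangent_basis A x) : \det (basis_mx c b) != 0.
  by have := basis_mx_unit b cx; rewrite unitmxE unitfE.
pose P : set (tangent_basis A x) := [set b | 0 < \det (basis_mx c b)].
have PP b b' : same_orientation b b' <-> (P b <-> P b').
  by rewrite (same_orientationE _ _ cx) gt0_mulr_iff.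
have pO : chart_positive c (Orientation PP).
  by rewrite (chart_positiveE cx) /= /P /= det_basis_mx_coord.
case: s; first by exists (Orientation PP).
by exists (opp_orientation (Orientation PP)); rewrite chart_positive_opp.
Qed.

End Orientations.

(** * Pseudo-functions in charts *)

Section PseudoFunctions.
Context {R : realType} {n : nat} {N : topologicalType} {A : set (chart R n N)}.
Hypothesis mA : smooth_manifold A.
Implicit Types (c : chart R n N) (x : N) (F : double_cover A -> R).

(** One of the two lifts of [c] suffices: for an odd function the other lift gives the negative, see
    [local_rep_false]. *)
Definition rep c F : 'rV[R]_n -> R := local_rep (cover_chart A c true) F.

Definition odd_fun F := forall p, F (cover_involution p) = - F p.

Lemma cover_chart_inj c s : A c ->
  {in chart_dom (cover_chart A c s) &, injective (chart_map (cover_chart A c s))}.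
Proof.
move=> Ac [x w] [x' w']; rewrite !inE => -[/= cx Os] [/= cx' O's] E.
have xx' : x = x' by apply: (chart_inj mA Ac); rewrite ?inE.
subst x'; congr existT; apply: (orientation_eq mA (conj Ac cx)).
by rewrite Os O's.
Qed.

Lemma cover_img c s : A c -> chart_img (cover_chart A c s) = chart_img c.
Proof.
move=> Ac; apply/seteqP; split=> [_ [[x w] [/= cx Os] <-]|_ [x cx <-]]; first by exists x.
have [w Os] := chart_orientation mA s (conj Ac cx).
by exists (existT _ x w).
Qed.

Lemma cover_repE c (s : bool) x (w : orientation A x) F : A c -> chart_dom c x ->
  (chart_positive c w <-> s) ->
  local_rep (cover_chart A c s) F (chart_map c x) = F (existT _ x w).
Proof.
move=> Ac cx Os.
exact: (@local_repE _ _ _ _ (cover_chart A c s) F (existT _ x w) (cover_chart_inj Ac)).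
Qed.

Lemma repE c x (w : orientation A x) F : A c -> chart_dom c x ->
  chart_positive c w -> rep c F (chart_map c x) = F (existT _ x w).
Proof. by move=> Ac cx Op; apply: cover_repE. Qed.

Lemma repNE c x (w : orientation A x) F : odd_fun F -> A c -> chart_dom c x ->
  ~ chart_positive c w -> rep c F (chart_map c x) = - F (existT _ x w).
Proof.
move=> oF Ac cx Op; rewrite -oF; apply: repE => //=.
by rewrite (chart_positive_opp mA _ (conj Ac cx)).
Qed.

Lemma rep_out c F y : A c -> ~ chart_img c y -> rep c F y = 0.
Proof. by move=> Ac ny; apply: local_rep_out; rewrite cover_img. Qed.

Lemma local_rep_false c F : odd_fun F -> A c ->
  local_rep (cover_chart A c false) F = - rep c F.
Proof.
move=> oF Ac; apply/funext => y; rewrite opprfctE.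
have [[x cx <-]|ny] := pselect (chart_img c y); last first.
  by rewrite rep_out // oppr0 local_rep_out // cover_img.
have [w Os] := chart_orientation mA false (conj Ac cx).
rewrite (cover_repE _ Ac cx Os) (@repNE c x w) ?opprK //.
by move=> /Os.
Qed.

Lemma smooth_pseudoE F : odd_fun F ->
  smooth (cover_atlas A) F <-> forall c, A c -> smooth_on (chart_img c) (rep c F).
Proof.
move=> oF; split=> [sF c Ac|sF _ [c Ac [[] _ <-]]].
- have := sF (cover_chart A c true); rewrite -/(chart_img _) cover_img //; apply.
  by exists c => //; exists true.
- by rewrite -/(chart_img _) cover_img //; exact: sF.
- rewrite -/(chart_img _) cover_img // local_rep_false //.
  by apply: smooth_onN; [exact: (chart_img_open mA)|exact: sF].
Qed.

Definition transition_sign c c' x : R := if 0 < \det (tjac c c' x) then 1 else -1.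

Lemma rep_change c c' x F : odd_fun F -> chart_at A x c -> chart_at A x c' ->
  rep c F (chart_map c x) = transition_sign c c' x * rep c' F (chart_map c' x).
Proof.
move=> oF cx c'x; rewrite /transition_sign.
have [w Oc] := chart_orientation mA true cx.
have E := chart_positive_transition mA w cx c'x.
have pc : chart_positive c w by apply/Oc.
rewrite (repE _ cx.1 cx.2 pc).
case: ifP => [/E H|/negP H].
  by rewrite mul1r (@repE c' x w) ?c'x.1 ?c'x.2 //; [exact: c'x.1|exact: c'x.2|exact/H].
rewrite mulN1r (@repNE c' x w) ?opprK //; [exact: c'x.1|exact: c'x.2|].
by move=> p'; apply: H; apply/E.
Qed.

(** The sign is frozen at its value at [x], so this is an equality of germs with a constant factor
    and can be differentiated. *)
Lemma rep_change_near c c' x F : odd_fun F -> chart_at A x c -> chart_at A x c' ->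
  \forall y \near chart_map c x,
    rep c F y = transition_sign c c' x * rep c' F (transition c c' y).
Proof.
move=> oF [Ac cx] [Ac' c'x].
have := chart_inv_near mA Ac cx (det_tjac_near mA Ac Ac' cx c'x).
apply: filterS => _ [x' [_ <- [cx' c'x' E]]].
rewrite (transitionE mA) // (rep_change oF (conj Ac cx') (conj Ac' c'x')).
by rewrite /transition_sign E.
Qed.

Lemma transition_sign_neq0 c c' x : transition_sign c c' x != 0.
Proof. by rewrite /transition_sign; case: ifP; rewrite ?oppr_eq0 oner_eq0. Qed.

Section ChangeOfChart.
Variables (F : double_cover A -> R) (c c' : chart R n N) (x : N).
Hypotheses (oF : odd_fun F) (sF : forall c, A c -> smooth_on (chart_img c) (rep c F)).
Hypotheses (cx : chart_at A x c) (c'x : chart_at A x c').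

Let T := transition c c'.
Let W := overlap c c'.
Let oW : open W. Proof. exact: (overlap_open mA cx.1 c'x.1). Qed.
Let sT : smooth_on W T. Proof. exact: (transition_smooth mA cx.1 c'x.1). Qed.
Let Wx : W (chart_map c x). Proof. by exists x => //; split; [exact: cx.2|exact: c'x.2]. Qed.
Let WT y : W y -> chart_img c' (T y).
Proof.
move=> [x' [cx' c'x'] <-]; rewrite /T (transitionE mA c' cx.1) //; by exists x'.
Qed.
Let oI : open (chart_img c'). Proof. exact: (chart_img_open mA c'x.1). Qed.
Let Tx : T (chart_map c x) = chart_map c' x.
Proof. exact: (transitionE mA c' cx.1 cx.2). Qed.

Lemma partial_change_near j : \forall y \near chart_map c x,
  'D_(basis_row j) (rep c F) y = transition_sign c c' x *
    \sum_k 'D_(basis_row k) (rep c' F) (T y) * 'D_(basis_row j) (coordf T k) y.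
Proof.
have nW : \forall y \near chart_map c x, W y by apply: near_open oW Wx _.
apply: filterS2 nW (nbhs_interior (rep_change_near oF cx c'x)) => y Wy E.
have D := is_derive_comp j oW oI sT (sF c'x.1) Wy (WT Wy).
rewrite (near_eq_derive _ E).
have -> : (fun y => transition_sign c c' x * rep c' F (T y)) =
  transition_sign c c' x *: (rep c' F \o T) by [].
by rewrite deriveZ; case: D => // _ ->.
Qed.

Lemma critical_change : (forall k, 'D_(basis_row k) (rep c' F) (chart_map c' x) = 0) ->
  forall j, 'D_(basis_row j) (rep c F) (chart_map c x) = 0.
Proof.
move=> H j; rewrite (nbhs_singleton (partial_change_near j)) Tx big1 ?mulr0 // => k _.
by rewrite H mul0r.
Qed.

Definition hess d F y : 'M[R]_n := \matrix_(i, j) iter_partial [:: i; j] (rep d F) y.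

Lemma hessE d y i j : hess d F y i j = iter_partial [:: i; j] (rep d F) y.
Proof. by rewrite mxE. Qed.

(** The second derivatives of the transition map enter multiplied by the gradient, which vanishes at
    the critical point; what is left is a congruence by an invertible Jacobian, up to sign. *)
Lemma hess_change : (forall k, 'D_(basis_row k) (rep c' F) (chart_map c' x) = 0) ->
  hess c F (chart_map c x) = transition_sign c c' x *:
    (tjac c c' x *m hess c' F (chart_map c' x) *m (tjac c c' x)^T).
Proof.
move=> H; apply/matrixP => i j; rewrite !mxE /=.
rewrite (near_eq_derive _ (partial_change_near j)).
pose G k := ('D_(basis_row k) (rep c' F) \o T) * 'D_(basis_row j) (coordf T k).
have dG k : is_derive (chart_map c x) (basis_row i) (G k)
    (\sum_l tjac c c' x i l * hess c' F (chart_map c' x) l k * tjac c c' x j k).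
  have D1 := is_derive_comp i oW oI sT (smooth_on_partial k (sF c'x.1)) Wx (WT Wx).
  have D2 := smooth_on_is_derive i (smooth_on_partial j (smooth_on_coord k oW sT)) Wx.
  have := is_deriveM D1 D2; move/is_derive_eq; apply.
  rewrite /= Tx H scale0r add0r /GRing.scale /= mulr_sumr.
  apply: eq_bigr => l _; rewrite !tjacE hessE /=; ring.
have -> : (fun y => transition_sign c c' x *
    \sum_k 'D_(basis_row k) (rep c' F) (T y) * 'D_(basis_row j) (coordf T k) y) =
    transition_sign c c' x *: (\sum_k G k).
  by apply/funext => y; rewrite scalrfctE fct_sumE.
have := @is_derive_sum _ _ _ _ _ _ _ _ dG.
move=> [dS vS]; rewrite deriveZ // vS; congr (_ * _).
apply: eq_bigr => k _; rewrite !mxE mulr_suml.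
by apply: eq_bigr => l _; rewrite !mxE.
Qed.

End ChangeOfChart.

Definition crit F x := forall c, chart_at A x c ->
  forall i, 'D_(basis_row i) (rep c F) (chart_map c x) = 0.

Section SmoothPseudo.
Variables (F : double_cover A -> R).
Hypotheses (oF : odd_fun F) (sF : forall c, A c -> smooth_on (chart_img c) (rep c F)).

Lemma crit_chart c x : chart_at A x c ->
  (forall i, 'D_(basis_row i) (rep c F) (chart_map c x) = 0) -> crit F x.
Proof. by move=> cx H c' c'x; exact: critical_change cx H. Qed.

Lemma hess_unit_change c c' x : chart_at A x c -> chart_at A x c' -> crit F x ->
  hess c' F (chart_map c' x) \in unitmx -> hess c F (chart_map c x) \in unitmx.
Proof.
move=> cx c'x Fx H.
have J : tjac c c' x \in unitmx by apply: (tjac_unit mA cx.1 c'x.1 cx.2 c'x.2).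
rewrite (hess_change oF sF cx c'x (Fx _ c'x)) unitmxZ ?unitfE ?transition_sign_neq0 //.
by rewrite !unitmx_mul J H unitmx_tr.
Qed.

Lemma iter_partial_cover c s t x : chart_at A x c ->
  iter_partial t (local_rep (cover_chart A c s) F) (chart_map c x) =
  (if s then 1 else -1) * iter_partial t (rep c F) (chart_map c x).
Proof.
move=> [Ac cx]; case: s; first by rewrite mul1r.
rewrite local_rep_false // mulN1r (iter_partialN _ (chart_img_open mA Ac)) //.
  exact: sF.
by exists x.
Qed.

Lemma critical_pointE p : critical_point (cover_atlas A) F p <-> crit F (projT1 p).
Proof.
case: p => x w /=; split=> [H|H _ [c Ac [s _ <-]] [/= cx Os] i]; last first.
  apply: (etrans (@iter_partial_cover c s [:: i] x (conj Ac cx))).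
  by rewrite /= H ?mulr0.
have [c Ac cx] := chart_exists mA x.
apply: (@crit_chart c) => // i.
pose s := `[< chart_positive c w >].
have Os : chart_positive c w <-> s by rewrite /s; split => /asboolP.
have mem : cover_atlas A (cover_chart A c s) by exists c => //; exists s.
have := H _ mem (conj cx Os) i.
move/(etrans (esym (@iter_partial_cover c s [:: i] x (conj Ac cx))))/eqP.
by rewrite mulf_eq0; case: s {Os mem}; rewrite ?oppr_eq0 oner_eq0 /= => /eqP.
Qed.

Lemma hessian_cover c s x (w : orientation A x) : chart_at A x c ->
  hessian (cover_chart A c s) F (existT _ x w) =
  (if s then 1 else -1) *: hess c F (chart_map c x).
Proof.
move=> cx; apply/matrixP => i j; rewrite !mxE.
exact: (@iter_partial_cover c s [:: i; j] x cx).
Qed.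

Lemma nondegenerate_chart c p : crit F (projT1 p) -> chart_at A (projT1 p) c ->
  Defs.nondegenerate (cover_atlas A) F p <->
  hess c F (chart_map c (projT1 p)) \in unitmx.
Proof.
case: p => x w /= Fx cx.
have sU (s : bool) : (if s then 1 else -1 : R) \is a GRing.unit.
  by rewrite unitfE; case: s; rewrite ?oppr_eq0 oner_eq0.
split=> [H|H _ [c' Ac' [s _ <-]] [/= c'x Os]].
  pose s := `[< chart_positive c w >].
  have Os : chart_positive c w <-> s by rewrite /s; split => /asboolP.
  have mem : cover_atlas A (cover_chart A c s).
    by exists c; [exact: cx.1|exists s].
  have := H _ mem; rewrite /= => /(_ (conj cx.2 Os)).
  by rewrite (hessian_cover s w cx) (unitmxZ _ (sU s)).
rewrite (hessian_cover s w (conj Ac' c'x)) (unitmxZ _ (sU s)).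
exact: hess_unit_change (conj Ac' c'x) cx Fx H.
Qed.

End SmoothPseudo.

End PseudoFunctions.

(** * The C^2-topology *)

Section LocalRepLinear.
Context {R : realType} {n : nat} {M : Type}.

Lemma local_repD (c : chart R n M) (F G : M -> R) :
  {in chart_dom c &, injective (chart_map c)} ->
  local_rep c (F + G) = local_rep c F + local_rep c G.
Proof.
move=> ic; apply/funext => y; rewrite [in RHS]addrfctE.
have [[x cx <-]|ny] := pselect (chart_img c y); last first.
  by rewrite !local_rep_out // addr0.
by rewrite !local_repE.
Qed.

Lemma local_rep_sum (c : chart R n M) m (a : 'I_m -> R) (G : 'I_m -> M -> R) :
  {in chart_dom c &, injective (chart_map c)} ->
  local_rep c (\sum_k a k *: G k) = \sum_k a k *: local_rep c (G k).
Proof.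
move=> ic; apply/funext => y.
have [[x cx <-]|ny] := pselect (chart_img c y).
  by rewrite local_repE // !fct_sumE; apply: eq_bigr => k _; rewrite !scalrfctE local_repE.
rewrite local_rep_out // [in RHS]fct_sumE big1 // => k _.
by rewrite scalrfctE local_rep_out // scaler0.
Qed.

End LocalRepLinear.

Lemma iter_partial_sum (R : realType) n (U : set 'rV[R]_n) s m (a : 'I_m -> R)
    (G : 'I_m -> 'rV[R]_n -> R) : open U -> (forall k, smooth_on U (G k)) ->
  forall y, U y -> iter_partial s (\sum_k a k *: G k) y =
    \sum_k a k * iter_partial s (G k) y.
Proof.
move=> oU sG y Uy.
have sS (r : seq 'I_m) : smooth_on U (\sum_(k <- r) a k *: G k).
  apply: (smooth_on_sum r (F := fun k => a k *: G k) oU) => k.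
  exact: (smooth_onZ (a k) oU (sG k)).
suff H (r : seq 'I_m) : iter_partial s (\sum_(k <- r) a k *: G k) y =
    \sum_(k <- r) a k * iter_partial s (G k) y by exact: H.
elim: r => [|k r IH].
  rewrite !big_nil.
  have -> : (0 : 'rV[R]_n -> R) = cst 0 by [].
  by rewrite iter_partial_cst; case: s.
rewrite !big_cons (iter_partialD s oU) //; last exact: smooth_onZ.
by rewrite IH (iter_partialZ s _ oU).
Qed.

Section Topology.
Context {R : realType} {n : nat} {N : topologicalType} {A : set (chart R n N)}.
Hypothesis mA : smooth_manifold A.

Definition pfun (F : pseudo_functions A) : double_cover A -> R :=
  (set_val F : smooth_fun (cover_atlas A)).

Lemma pfun_odd F : odd_fun (pfun F).
Proof. by have := set_valP F. Qed.

Lemma pfun_smooth F c : A c -> smooth_on (chart_img c) (rep c (pfun F)).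
Proof.
move: c; apply/(smooth_pseudoE mA (@pfun_odd F)).
exact: (smooth_funP (set_val F)).
Qed.

Lemma exists_pfun F : odd_fun F ->
  (forall c, A c -> smooth_on (chart_img c) (rep c F)) ->
  exists G : pseudo_functions A, pfun G = F.
Proof.
move=> oF /(smooth_pseudoE mA oF) sF.
have pF : pseudo_functions A (SmoothFun sF) by exact: oF.
by exists (exist _ (SmoothFun sF) (mem_set pF)); rewrite /pfun set_valE.
Qed.

Lemma C2_nbhd_open (f : smooth_fun (cover_atlas A)) c K e : cover_atlas A c ->
  compact K -> K `<=` chart_img c -> 0 < e -> open (C2_nbhd f c K e).
Proof.
move=> Ac cK Kc e0.
have D : C2_subbase (C2_nbhd f c K e) by exists f, c, K, e.
exists [set C2_nbhd f c K e]; last by rewrite bigcup_set1.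
by move=> _ ->; exact: finI_from1.
Qed.

Lemma nbhs_C2 (F : pseudo_functions A) c K e : A c -> compact K ->
  K `<=` chart_img c -> 0 < e ->
  \forall G \near F, forall s y, (size s <= 2)%N -> K y ->
    `|iter_partial s (rep c (pfun G)) y - iter_partial s (rep c (pfun F)) y| < e.
Proof.
move=> Ac cK Kc e0.
have cs : continuous (set_val : pseudo_functions A -> _) by exact: initial_continuous.
apply: (cs F [set G | C2_nbhd (set_val F) (cover_chart A c true) K e G]).
apply: open_nbhs_nbhs; split; last by move=> s y _ _; rewrite subrr normr0.
apply: C2_nbhd_open => //; first by exists c => //; exists true.
by rewrite (cover_img mA).
Qed.

(** Open sets are unions of finite intersections of subbasic sets, so it suffices to test subbasic
    sets containing [F]. Their centre [f] may differ from [F]: what is available at [F] is a strict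
    inequality, not the full radius [e]. *)
Lemma cvg_pseudo (I : Type) (Phi : set_system I) (g : I -> pseudo_functions A)
    (F : pseudo_functions A) : Filter Phi ->
  (forall f c K e, cover_atlas A c -> compact K -> K `<=` chart_img c ->
    C2_nbhd f c K e (set_val F) -> \forall i \near Phi, C2_nbhd f c K e (set_val (g i))) ->
  g i @[i --> Phi] --> F.
Proof.
move=> FPhi H W [_ [[W' oW' <-] W'F] W'W].
apply: filterS W'W _.
case: oW' W'F => D' D'fin <- [B D'B FB] {W'}.
have nB : \forall i \near Phi, (B : set (smooth_fun (cover_atlas A))) (set_val (g i)).
  have [D DC2 EB] := D'fin _ D'B.
  move: FB; rewrite -EB => FB.
  apply: filter_bigI => B' B'D.
  have /set_mem[f [c [K [e [Ac cK Kc e0 E]]]]] := DC2 B' B'D.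
  rewrite E; apply: H => //; rewrite -E.
  exact: (FB B' B'D).
by apply: filterS nB => i Bi; exists B.
Qed.
End Topology.

Lemma near_sum_small (R : realType) m (C : 'I_m -> R) (e : R) : 0 < e ->
  \forall a \near (0 : 'rV[R]_m), \sum_k `|(a : 'rV[R]_m) 0 k| * `|C k| < e.
Proof.
move=> e0; pose S := \sum_k `|C k| + 1.
have S0 : 0 < S by rewrite ltr_wpDl // sumr_ge0.
suff : nbhs (0 : 'rV[R]_m) [set a : 'rV[R]_m | \sum_k `|a 0 k| * `|C k| < e] by [].
apply/nbhs_ballP; exists (e / S) => /=; first exact: divr_gt0.
move=> a; rewrite -ball_normE /= sub0r normrN => ae.
apply: (@le_lt_trans _ _ (`|a| * \sum_k `|C k|)).
  by rewrite mulr_sumr; apply: ler_sum => k _; rewrite ler_wpM2r // norm_coord.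
apply: (@le_lt_trans _ _ (`|a| * S)); first by rewrite ler_wpM2l // lerDl.
by rewrite -ltr_pdivlMr.
Qed.

(** * Perturbations by finitely many pseudo-functions *)

Section Perturbation.
Context {R : realType} {n : nat} {N : topologicalType} {A : set (chart R n N)}.
Hypothesis mA : smooth_manifold A.

Lemma rep_lin c (F : double_cover A -> R) m (a : 'I_m -> R) G : A c ->
  rep c (F + \sum_k a k *: G k) = rep c F + \sum_k a k *: rep c (G k).
Proof.
move=> Ac; rewrite /rep local_repD; last exact: (cover_chart_inj mA).
by rewrite local_rep_sum //; exact: (cover_chart_inj mA).
Qed.

(** [u] stands for a derivative of [F] minus that of the centre of a subbasic set, the [v k] for
    derivatives of the perturbing functions. Near a point, |u| stays below some e1 < e and the [v k]
    stay bounded, which leaves e - e1 for the perturbation; compactness of [K] makes this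
    uniform. *)
Lemma near_perturbation (n' : nat) (U K : set 'rV[R]_n') u m (v : 'I_m -> 'rV[R]_n' -> R)
    (e : R) : compact K -> K `<=` U -> smooth_on U u ->
  (forall k, smooth_on U (v k)) -> (forall y, K y -> `|u y| < e) ->
  \forall a \near (0 : 'rV[R]_m), forall y, K y ->
    `|u y + \sum_k (a : 'rV[R]_m) 0 k * v k y| < e.
Proof.
move=> /compact_near_coveringP cK KU su sv ue.
have FF := nbhs_filter (0 : 'rV[R]_m).
apply: (cK _ (nbhs (0 : 'rV[R]_m))
  (fun (a : 'rV[R]_m) y => `|u y + \sum_k a 0 k * v k y| < e) FF) => y Ky.
have FFy := nbhs_filter y.
pose e1 := (`|u y| + e) / 2.
have h1 : `|u y| < e1 by have := ue y Ky; rewrite /e1; lra.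
have h2 : e1 < e by have := ue y Ky; rewrite /e1; lra.
pose C k := `|v k y| + 1.
have nu : \forall z \near y, `|u z| < e1.
  have /cvg_norm cu : u z @[z --> y] --> u y := smooth_on_continuous su (KU _ Ky).
  exact: (cvgr_lt _ cu).
have nv k : \forall z \near y, `|v k z| < C k.
  have /cvg_norm cv : v k z @[z --> y] --> v k y := smooth_on_continuous (sv k) (KU _ Ky).
  by apply: (cvgr_lt _ cv); rewrite ltrDl.
have {}nv := @filter_forall _ _ _ _ FFy nv.
have na := @near_sum_small R m C (e - e1).
exists ([set z | `|u z| < e1 /\ forall k, `|v k z| < C k],
        [set a : 'rV[R]_m | \sum_k `|a 0 k| * `|C k| < e - e1]).
  split; first exact: filterI nu nv.
  by apply: na; rewrite subr_gt0.
move=> [z a] [/= [uz vz] az].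
apply: le_lt_trans (ler_normD _ _) _.
rewrite -[e](subrKC e1); apply: ltr_leD => //.
apply: le_trans (ltW az); apply: le_trans (ler_norm_sum _ _ _) _.
apply: ler_sum => k _; rewrite normrM ler_wpM2l //.
by rewrite (le_trans (ltW (vz k))) // ler_norm.
Qed.

Lemma exists_perturbation (F : pseudo_functions A) m (G : 'I_m -> pseudo_functions A) :
  exists pert : 'rV[R]_m -> pseudo_functions A,
    (forall a, pfun (pert a) = pfun F + \sum_k a 0 k *: pfun (G k)) /\
    pert a @[a --> (0 : 'rV[R]_m)] --> F.
Proof.
have ex (a : 'rV[R]_m) : exists H : pseudo_functions A,
    pfun H = pfun F + \sum_k a 0 k *: pfun (G k).
  apply: (exists_pfun mA) => [p|c Ac].
    rewrite !addrfctE !fct_sumE (pfun_odd F) opprD -sumrN; congr (_ + _).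
    by apply: eq_bigr => k _; rewrite !scalrfctE (pfun_odd (G k)) scalerN.
  have oc := chart_img_open mA Ac.
  rewrite rep_lin //; apply: (smooth_onD oc); first exact: (pfun_smooth mA F Ac).
  apply: (smooth_on_sum _ (F := fun k => a 0 k *: rep c (pfun (G k))) oc) => k.
  exact: (smooth_onZ (a 0 k) oc (pfun_smooth mA (G k) Ac)).
have [pert pertE] := choice ex; exists pert; split => //.
have FF := nbhs_filter (0 : 'rV[R]_m).
apply: (cvg_pseudo (Phi := nbhs (0 : 'rV[R]_m)) (g := pert)) => f cc K e Acc cK Kc FB.
have [c Ac [s _ ccE]] := Acc.
have icc : {in chart_dom cc &, injective (chart_map cc)}.
  by rewrite -ccE; exact: (cover_chart_inj mA).
have occ : open (chart_img cc).
  by rewrite -ccE (cover_img mA) //; exact: (chart_img_open mA).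
have sH (H : pseudo_functions A) : smooth_on (chart_img cc) (local_rep cc (pfun H)).
  exact: (smooth_funP (set_val H) Acc).
have sf : smooth_on (chart_img cc) (local_rep cc f) by exact: (smooth_funP f Acc).
have one t : (size t <= 2)%N -> \forall a \near (0 : 'rV[R]_m), forall y, K y ->
    `|iter_partial t (local_rep cc (pfun (pert a))) y - iter_partial t (local_rep cc f) y| < e.
  move=> t2; pose u := iter_partial t (local_rep cc (pfun F)) - iter_partial t (local_rep cc f).
  pose v k := iter_partial t (local_rep cc (pfun (G k))).
  have su : smooth_on (chart_img cc) u.
    apply: (smooth_onD occ); first exact: (smooth_on_iter t (sH F)).
    exact: (smooth_onN occ (smooth_on_iter t sf)).
  have ue y : K y -> `|u y| < e by move=> Ky; exact: (FB t y t2 Ky).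
  have := near_perturbation cK Kc su (fun k => smooth_on_iter t (sH (G k))) ue.
  apply: filterS => a H y Ky.
  have sS : smooth_on (chart_img cc) (\sum_k a 0 k *: local_rep cc (pfun (G k))).
    apply: (smooth_on_sum _ (F := fun k => a 0 k *: local_rep cc (pfun (G k))) occ) => k.
    exact: (smooth_onZ (a 0 k) occ (sH (G k))).
  rewrite pertE local_repD // local_rep_sum //.
  rewrite (iter_partialD t occ (sH F) sS (Kc _ Ky)).
  rewrite (iter_partial_sum t _ occ (fun k => sH (G k)) (Kc _ Ky)).
  rewrite addrAC; exact: H.
(* Sequences of length at most 2 are enumerated as tuples of length [k : 'I_3], a finite family, so
   that the neighbourhoods obtained one by one can be intersected. *)
have all : \forall a \near (0 : 'rV[R]_m), forall (k : 'I_3) (t : k.-tuple 'I_n), forall y, K y ->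
    `|iter_partial t (local_rep cc (pfun (pert a))) y - iter_partial t (local_rep cc f) y| < e.
  apply: (@filter_forall _ _ _ _ FF) => k; apply: (@filter_forall _ _ _ _ FF) => t.
  by apply: one; rewrite size_tuple -ltnS.
apply: filterS all => a H t y t2 Ky.
have t3 : (size t < 3)%N by rewrite ltnS.
exact: (H (Ordinal t3) (in_tuple t) y Ky).
Qed.

End Perturbation.

(** * Bump pseudo-functions supported in one chart *)

Section BumpPseudo.
Context {R : realType} {n : nat} {N : topologicalType} {A : set (chart R n N)}.
Hypothesis mA : smooth_manifold A.
Variables (c : chart R n N) (phi : 'rV[R]_n -> R) (C : set 'rV[R]_n).
Hypotheses (Ac : A c) (sphi : smooth_on setT phi) (cC : compact C)
  (CU : C `<=` chart_img c) (phi0 : forall y, ~ C y -> phi y = 0).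

Definition bump_pseudo (p : double_cover A) : R :=
  if pselect (chart_dom c (projT1 p)) then
    (if pselect (chart_positive c (projT2 p)) then 1 else -1) * phi (chart_map c (projT1 p))
  else 0.

Lemma bump_pseudo_odd : odd_fun bump_pseudo.
Proof.
move=> [x w]; rewrite /bump_pseudo /=; case: pselect => [cx|ncx]; last by rewrite oppr0.
have E := chart_positive_opp mA w (conj Ac cx).
by case: pselect => h; case: pselect => h'; rewrite ?mulN1r ?mul1r ?opprK //; tauto.
Qed.

Lemma rep_bump_pseudo : rep c bump_pseudo = phi.
Proof.
apply/funext => y; have [[x cx <-]|ny] := pselect (chart_img c y); last first.
  by rewrite (rep_out mA) // phi0 // => /CU.
have [w Os] := chart_orientation mA true (conj Ac cx).
rewrite (@repE _ _ _ _ mA c x w) //; last exact/Os.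
rewrite /bump_pseudo /=; case: pselect => [cx'|//].
by case: pselect => [wp|[]]; [rewrite mul1r|exact/Os].
Qed.

(** It is the image of [C] under the inverse of the chart, which is continuous on [C]. In the
    Hausdorff space [N] this set is then closed, as the extension by zero requires. *)
Lemma compact_chart_preimage : compact [set x | chart_dom c x /\ C (chart_map c x)].
Proof.
have [[x0 _]|nx] := pselect (exists x, chart_dom c x /\ C (chart_map c x)); last first.
  rewrite (_ : [set x | _] = set0); first exact: compact0.
  by apply/seteqP; split => // x Hx; case: nx; exists x.
pose inv y := xget x0 [set x | chart_dom c x /\ chart_map c x = y].
have invE x : chart_dom c x -> inv (chart_map c x) = x.
  move=> cx; apply: xget_unique => // x' [cx' E].
  by apply: (chart_inj mA Ac); rewrite ?inE.
have -> : [set x | chart_dom c x /\ C (chart_map c x)] = inv @` C.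
  apply/seteqP; split=> [x [cx Cx]|_ [y Cy <-]]; first by exists (chart_map c x); rewrite ?invE.
  by have [x cx E] := CU Cy; rewrite -E invE //= E.
apply: continuous_compact => //; apply: continuous_in_subspaceT => y.
rewrite inE => /CU[x cx <-] P; rewrite invE // => nP.
have := chart_inv_near mA Ac cx nP; apply: filterS => _ [x' [cx' <- Px']].
by rewrite /= invE.
Qed.

Lemma bump_pseudo_out x : ~ (chart_dom c x /\ C (chart_map c x)) ->
  forall w, bump_pseudo (existT _ x w) = 0.
Proof.
move=> nx w; rewrite /bump_pseudo /=; case: pselect => [cx|//].
by rewrite phi0 ?mulr0 // => Cx; apply: nx.
Qed.

Lemma closed_chart_preimage : closed [set x | chart_dom c x /\ C (chart_map c x)].
Proof. by apply: compact_closed; [case: mA|exact: compact_chart_preimage]. Qed.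

(** At a point of [chart_dom c] the representative is, up to a constant sign, [phi] composed with a
    transition map. Any other point has a neighbourhood missing the closed preimage of [C], where
    the function is 0. *)
Lemma smooth_bump_pseudo c' : A c' -> smooth_on (chart_img c') (rep c' bump_pseudo).
Proof.
move=> Ac'; apply: smooth_on_near => _ [x c'x <-].
have [cx|ncx] := pselect (chart_dom c x).
  have oW := overlap_open mA Ac' Ac.
  exists (transition_sign c' c x *: (phi \o transition c' c)), (overlap c' c); split.
  - by exists x.
  - apply: (smooth_onZ _ oW); apply: (smooth_on_comp oW openT) => //.
    exact: (transition_smooth mA Ac' Ac).
  - have := rep_change_near mA bump_pseudo_odd (conj Ac' c'x) (conj Ac cx).
    by rewrite rep_bump_pseudo.
exists (cst 0), setT; split; [exact: I|exact: smooth_on_cst|].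
have nP : \forall x' \near x, ~ (chart_dom c x' /\ C (chart_map c x')).
  apply: open_nbhs_nbhs; split; last by case.
  exact: (closed_openC closed_chart_preimage).
apply: filterS (chart_inv_near mA Ac' c'x nP) => _ [x' [c'x' <- nx']] /=.
have [w Os] := chart_orientation mA true (conj Ac' c'x').
by rewrite (@repE _ _ _ _ mA c' x' w) ?bump_pseudo_out //; exact/Os.
Qed.

Lemma exists_bump_pseudo : exists G : pseudo_functions A, pfun G = bump_pseudo.
Proof. by apply: (exists_pfun mA); [exact: bump_pseudo_odd|exact: smooth_bump_pseudo]. Qed.

End BumpPseudo.

(** * Simple Morse pseudo-functions *)

Section SimpleMorse.
Context {R : realType} {n : nat} {N : topologicalType} {A : set (chart R n N)}.
Hypothesis mA : smooth_manifold A.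
Implicit Types (F G : pseudo_functions A) (c : chart R n N) (x : N).

Definition nondeg F x := crit (pfun F) x ->
  forall c, chart_at A x c -> hess c (pfun F) (chart_map c x) \in unitmx.

Lemma nondeg_chart F c x : chart_at A x c ->
  hess c (pfun F) (chart_map c x) \in unitmx -> nondeg F x.
Proof.
move=> cx H Fx c' c'x.
exact: (hess_unit_change mA (pfun_odd F) (@pfun_smooth _ _ _ _ mA F) c'x cx Fx H).
Qed.

Lemma orientation_exists x : exists w : orientation A x, True.
Proof.
have [c Ac cx] := chart_exists mA x.
by have [w _] := chart_orientation mA true (conj Ac cx); exists w.
Qed.

Lemma morseP F : morse (cover_atlas A) (pfun F) <-> forall x, nondeg F x.
Proof.
have sF := @pfun_smooth _ _ _ _ mA F.
have cE p := critical_pointE mA (pfun_odd F) sF p.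
have nE c p := @nondegenerate_chart _ _ _ _ mA (pfun F) (pfun_odd F) sF c p.
split=> [[_ H] x Fx c cx|H].
  have [w _] := orientation_exists x.
  have Fp : critical_point (cover_atlas A) (pfun F) (existT _ x w) by apply/cE.
  by have /(nE c) := H _ Fp; apply.
split=> [|p /cE Fp]; first exact: (smooth_funP (set_val F)).
have [c Ac cx] := chart_exists mA (projT1 p).
by apply/(nE c) => //; apply: H.
Qed.

Lemma pfun_rep F c x (w : orientation A x) : chart_at A x c ->
  pfun F (existT _ x w) =
    (if pselect (chart_positive c w) then 1 else -1) * rep c (pfun F) (chart_map c x).
Proof.
move=> [Ac cx]; case: pselect => wp.
  by rewrite mul1r (@repE _ _ _ _ mA c x w).
by rewrite (repNE mA (@pfun_odd _ _ _ _ F) Ac cx wp) mulN1r opprK.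
Qed.

Lemma norm_rep F c x (w : orientation A x) : chart_at A x c ->
  `|pfun F (existT _ x w)| = `|rep c (pfun F) (chart_map c x)|.
Proof.
move=> cx; rewrite (pfun_rep F w cx) normrM.
by case: pselect => wp; rewrite ?normrN normr1 mul1r.
Qed.

Lemma norm_rep_change F c c' x : chart_at A x c -> chart_at A x c' ->
  `|rep c (pfun F) (chart_map c x)| = `|rep c' (pfun F) (chart_map c' x)|.
Proof.
by move=> cx c'x; have [w _] := orientation_exists x; rewrite -!(norm_rep F w).
Qed.

Definition nonzero_value F x :=
  forall c, chart_at A x c -> rep c (pfun F) (chart_map c x) != 0.

Definition distinct_values F x x' := forall c c', chart_at A x c -> chart_at A x' c' ->
  `|rep c (pfun F) (chart_map c x)| != `|rep c' (pfun F) (chart_map c' x')|.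

Lemma nonzero_value_chart F c x : chart_at A x c ->
  rep c (pfun F) (chart_map c x) != 0 -> nonzero_value F x.
Proof. by move=> cx H c' c'x; rewrite -normr_eq0 (norm_rep_change F c'x cx) normr_eq0. Qed.

Lemma distinct_values_chart F c c' x x' : chart_at A x c -> chart_at A x' c' ->
  `|rep c (pfun F) (chart_map c x)| != `|rep c' (pfun F) (chart_map c' x')| ->
  distinct_values F x x'.
Proof.
by move=> cx c'x H d d' dx d'x; rewrite (norm_rep_change F dx cx) (norm_rep_change F d'x c'x).
Qed.

(** The two points of the cover over a critical [x] have values v and -v, which differ exactly when
    v is nonzero. Over two critical points the values are v, -v, v', -v', so |v| and |v'| have to
    differ. *)
Lemma simple_morseP F : simple_morse (cover_atlas A) (pfun F) <->
  [/\ forall x, nondeg F x,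
      forall x, crit (pfun F) x -> nonzero_value F x &
      forall x x', crit (pfun F) x -> crit (pfun F) x' -> x <> x' ->
        distinct_values F x x'].
Proof.
have sF := @pfun_smooth _ _ _ _ mA F.
have cE p := critical_pointE mA (pfun_odd F) sF p.
split=> [[/morseP mF H]|[nF zF dF]].
  split=> // [x Fx c cx|x x' Fx Fx' xx' c c' cx c'x'].
    have [w wp] := chart_orientation mA true cx.
    have [w' w'p] := chart_orientation mA false cx.
    have := H (existT _ x w) (existT _ x w'); rewrite !cE /= => /(_ Fx Fx) {}H.
    apply/eqP => r0; apply: H.
      move=> /(congr1 (fun p => chart_positive c (projT2 p))) /= E.
      by have := wp.2 isT; rewrite E => /w'p.
    by rewrite (pfun_rep F w cx) (pfun_rep F w' cx) r0 !mulr0.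
  apply/eqP => E.
  have [w wp] := chart_orientation mA true cx.
  have xw (w' : orientation A x') : pfun F (existT _ x w) <> pfun F (existT _ x' w').
    by apply: H; rewrite ?cE // => /(congr1 (@projT1 _ _)).
  have Fw : pfun F (existT _ x w) = rep c (pfun F) (chart_map c x).
    by rewrite (pfun_rep F w cx); case: pselect => [wp'|[]]; rewrite ?mul1r //; exact/wp.
  have : rep c (pfun F) (chart_map c x) ^+ 2 == rep c' (pfun F) (chart_map c' x') ^+ 2.
    by rewrite -real_normK ?num_real // E real_normK ?num_real.
  (* The values agree up to sign; the orientation at [x'] is chosen so that they become equal on the
     cover. *)
  rewrite eqf_sqr => /orP[]/eqP rr.
    have [w' w'p] := chart_orientation mA true c'x'; apply: (xw w').
    rewrite Fw rr (pfun_rep F w' c'x'); case: pselect => [wp'|[]]; rewrite ?mul1r //; exact/w'p.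
  have [w' w'p] := chart_orientation mA false c'x'; apply: (xw w').
  by rewrite Fw rr (pfun_rep F w' c'x'); case: pselect => [/w'p //|wp']; rewrite mulN1r.
split; first exact/morseP.
move=> [x w] [x' w'] /cE /= Fx /cE /= Fx' pq.
have [c Ac cx] := chart_exists mA x; have [c' Ac' c'x'] := chart_exists mA x'.
have [xx'|xx'] := pselect (x = x'); last first.
  move=> E; have := dF x x' Fx Fx' xx' c c' (conj Ac cx) (conj Ac' c'x').
  by rewrite -(norm_rep F w) // -(norm_rep F w') // E eqxx.
subst x'; move=> E.
have := zF x Fx c (conj Ac cx); rewrite -normr_eq0 -(norm_rep F w) // normr_eq0 => /eqP; apply.
have nww' : ~ (chart_positive c w <-> chart_positive c w').
  by move=> H; apply: pq; congr existT; exact: (orientation_eq mA (conj Ac cx) H).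
move: E; rewrite (pfun_rep F w (conj Ac cx)) (pfun_rep F w' (conj Ac cx)).
case: pselect => wp; case: pselect => w'p; try by case: nww'; split.
  by rewrite !mul1r mulN1r => E; lra.
by rewrite !mul1r mulN1r => E; lra.
Qed.

End SimpleMorse.

(** * Stability of critical points and values along a filter *)

Section JointLimits.
Context {R : realType} {n : nat} {N : topologicalType} {A : set (chart R n N)}.
Hypothesis mA : smooth_manifold A.
Context {I : Type} (Phi : set_system I) {FPhi : Filter Phi}.
Implicit Types (F : pseudo_functions A) (c : chart R n N) (x : N).
Variables (g : I -> pseudo_functions A) (F : pseudo_functions A).
Hypothesis gF : g i @[i --> Phi] --> F.

Lemma exists_closed_ball c x : chart_at A x c -> exists2 r : R, 0 < r &
  closed_ball (chart_map c x) r `<=` chart_img c.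
Proof.
move=> [Ac cx].
have : nbhs (chart_map c x) (chart_img c).
  by apply: open_nbhs_nbhs; split; [exact: (chart_img_open mA)|exists x].
by move=> /nbhs_closedballP [r rU]; exists r%:num.
Qed.

Lemma near_C2_ball c x (r e : R) : chart_at A x c -> 0 < r -> 0 < e ->
  closed_ball (chart_map c x) r `<=` chart_img c ->
  \forall i \near Phi, forall s y, (size s <= 2)%N -> closed_ball (chart_map c x) r y ->
    `|iter_partial s (rep c (pfun (g i))) y - iter_partial s (rep c (pfun F)) y| < e.
Proof.
move=> [Ac cx] r0 e0 rU.
exact: (gF (nbhs_C2 mA F Ac (compact_closed_ball r0) rU e0)).
Qed.

Section OnePoint.
Variables (X : I -> N) (x : N) (c : chart R n N).
Hypotheses (Xx : X i @[i --> Phi] --> x) (cx : chart_at A x c).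

Lemma near_chart_at : \forall i \near Phi, chart_at A (X i) c.
Proof.
have [Ac cx'] := cx.
have nx : \forall x' \near x, chart_at A x' c.
  have : nbhs x (chart_dom c) by apply: open_nbhs_nbhs; split => //; exact: (chart_dom_open mA).
  by apply: filterS => x' cx''.
exact: (Xx nx).
Qed.

Lemma near_chart_ball (P : 'rV[R]_n -> Prop) : (\forall y \near chart_map c x, P y) ->
  \forall i \near Phi, P (chart_map c (X i)).
Proof.
move=> nP; have := chart_near mA cx.1 cx.2 nP => nx.
have : \forall i \near Phi, chart_dom c (X i) /\ P (chart_map c (X i)) by exact: (Xx nx).
by apply: filterS => i [].
Qed.

(** Half of [e] comes from uniform closeness of [g i] to [F] on a closed ball around the limit
    point, the other half from continuity of the partial derivative of [F]. *)
Lemma joint_cvg s : (size s <= 2)%N ->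
  iter_partial s (rep c (pfun (g i))) (chart_map c (X i)) @[i --> Phi] -->
  iter_partial s (rep c (pfun F)) (chart_map c x).
Proof.
move=> s2; apply/cvgrPdist_lt => e e0.
have [r r0 rU] := exists_closed_ball cx.
have e20 : 0 < e / 2 by rewrite divr_gt0.
have h1 := near_C2_ball cx r0 e20 rU.
have cimg : chart_img c (chart_map c x) by exists x => //; exact: cx.2.
have h2 : \forall y \near chart_map c x, closed_ball (chart_map c x) r y /\
    `|iter_partial s (rep c (pfun F)) (chart_map c x) - iter_partial s (rep c (pfun F)) y| < e / 2.
  apply: filterI.
    by apply/nbhs_closedballP; exists (PosNum r0).
  have := smooth_on_continuous (smooth_on_iter s (pfun_smooth mA F cx.1)) cimg.
  by move=> /cvgrPdist_lt /(_ _ e20).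
apply: filterS2 h1 (near_chart_ball h2) => i H [yK Hy].
rewrite (splitr e).
apply: le_lt_trans (ler_distD (iter_partial s (rep c (pfun F)) (chart_map c (X i))) _ _) _.
by apply: ltrD => //; rewrite distrC; exact: H.
Qed.

Lemma near_neq0 (u : I -> R) (a : R) : u i @[i --> Phi] --> a -> a != 0 ->
  \forall i \near Phi, u i != 0.
Proof. by move=> ua a0; exact: cvgr_neq0 ua a0. Qed.

Lemma near_noncrit : ~ crit (pfun F) x -> \forall i \near Phi, ~ crit (pfun (g i)) (X i).
Proof.
move=> nF; have [j /eqP Dj] : exists j, 'D_(basis_row j) (rep c (pfun F)) (chart_map c x) <> 0.
  apply: contrapT => H; apply: nF.
  apply: (crit_chart mA (pfun_odd F) (@pfun_smooth _ _ _ _ mA F) cx) => j.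
  by apply: contrapT => Dj; apply: H; exists j.
have := near_neq0 (@joint_cvg [:: j] isT) Dj.
apply: filterS2 near_chart_at => i ci Di gc.
by move/eqP: Di; apply; exact: gc.
Qed.

Lemma near_nondeg : nondeg F x -> \forall i \near Phi, nondeg (g i) (X i).
Proof.
have [Fx|nFx] := pselect (crit (pfun F) x); last first.
  by move=> _; apply: filterS (near_noncrit nFx) => i ng cg; case: ng.
move=> /(_ Fx c cx) U.
have D : \det (hess c (pfun (g i)) (chart_map c (X i))) @[i --> Phi] -->
    \det (hess c (pfun F) (chart_map c x)).
  apply: (@cvg_det R _ Phi _ n (fun i => hess c (pfun (g i)) (chart_map c (X i)))) => j k.
  rewrite hessE; under eq_cvg do rewrite hessE.
  exact: (@joint_cvg [:: j; k] isT).
have D0 : \det (hess c (pfun F) (chart_map c x)) != 0 by rewrite unitmxE unitfE in U.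
apply: filterS2 near_chart_at (near_neq0 D D0) => i ci Ui.
by apply: (nondeg_chart mA ci); rewrite unitmxE unitfE.
Qed.

Lemma near_nonzero_value : nonzero_value F x ->
  \forall i \near Phi, nonzero_value (g i) (X i).
Proof.
move=> /(_ c cx) H; have := near_neq0 (@joint_cvg [::] isT) H.
by apply: filterS2 near_chart_at => i ci; exact: nonzero_value_chart.
Qed.

End OnePoint.

Lemma near_distinct_values (X X' : I -> N) x x' : X i @[i --> Phi] --> x -> X' i @[i --> Phi] --> x' ->
  distinct_values F x x' -> \forall i \near Phi, distinct_values (g i) (X i) (X' i).
Proof.
move=> Xx X'x' H; have [c Ac cx] := chart_exists mA x; have [c' Ac' c'x'] := chart_exists mA x'.
have D : `|rep c (pfun (g i)) (chart_map c (X i))| -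
    `|rep c' (pfun (g i)) (chart_map c' (X' i))| @[i --> Phi] -->
    `|rep c (pfun F) (chart_map c x)| - `|rep c' (pfun F) (chart_map c' x')|.
  apply: cvgB; apply: cvg_norm.
    exact: (joint_cvg Xx (conj Ac cx) (s := [::]) isT).
  exact: (joint_cvg X'x' (conj Ac' c'x') (s := [::]) isT).
have D0 : `|rep c (pfun F) (chart_map c x)| - `|rep c' (pfun F) (chart_map c' x')| != 0.
  by rewrite subr_eq0; exact: H.
have h1 := near_chart_at Xx (conj Ac cx).
have h2 := near_chart_at X'x' (conj Ac' c'x').
have h3 : \forall i \near Phi, `|rep c (pfun (g i)) (chart_map c (X i))| -
    `|rep c' (pfun (g i)) (chart_map c' (X' i))| != 0 by exact: near_neq0 D D0.
apply: filterS3 h1 h2 h3 => i ci c'i; rewrite subr_eq0.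
exact: distinct_values_chart.
Qed.

(** Let D be the difference of the coordinates of two critical points of [g i]. The mean value
    theorem for the k-th partial derivative gives a relation sum_j D_j h_jk = 0, where the h_jk are
    second derivatives of [g i] taken at various points of the ball and lie within 2 e of the
    entries of [H0]. Hence D [H0] is at most 2 n e |D|, and applying the inverse of [H0] yields |D|
    <= |D| / 2. *)
Lemma near_unique_crit (X X' : I -> N) x : X i @[i --> Phi] --> x -> X' i @[i --> Phi] --> x ->
  crit (pfun F) x -> nondeg F x ->
  \forall i \near Phi, crit (pfun (g i)) (X i) -> crit (pfun (g i)) (X' i) -> X i = X' i.
Proof.
move=> Xx X'x Fx ndx; have [c Ac cx] := chart_exists mA x.
have cx' : chart_at A x c by [].
have U := ndx Fx c cx'; pose H0 := hess c (pfun F) (chart_map c x).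
pose C := \sum_i \sum_j `|invmx H0 j i|.
have C0 : 0 <= C by apply: sumr_ge0 => i _; exact: sumr_ge0.
(* Chosen so that 2 n e C is at most 1/2; the summand 1 keeps the inverted number positive when n C
   = 0. *)
pose e := (4 * (n%:R * C + 1))^-1.
have nC0 : 0 < n%:R * C + 1 by rewrite ltr_wpDl // mulr_ge0.
have e0 : 0 < e by rewrite invr_gt0 mulr_gt0.
have cimg : chart_img c (chart_map c x) by exists x.
have : \forall y \near chart_map c x, chart_img c y /\ forall j k,
    `|iter_partial [:: j; k] (rep c (pfun F)) y - H0 j k| < e.
  apply: filterI; first by apply: open_nbhs_nbhs; split => //; exact: (chart_img_open mA).
  have FF := nbhs_filter (chart_map c x).
  apply: (@filter_forall _ _ _ _ FF) => j; apply: (@filter_forall _ _ _ _ FF) => k.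
  have := smooth_on_continuous (smooth_on_iter [:: j; k] (pfun_smooth mA F Ac)) cimg.
  move=> /cvgrPdist_lt /(_ _ e0); apply: filterS => y.
  by rewrite distrC /H0 mxE.
move=> /nbhs_closedballP[r rP].
have rU : closed_ball (chart_map c x) r%:num `<=` chart_img c by move=> y /rP[].
have h1 := near_C2_ball cx' (gt0 r) e0 rU.
have nb : \forall y \near chart_map c x, closed_ball (chart_map c x) r%:num y.
  by apply/nbhs_closedballP; exists r.
have h2 : \forall i \near Phi, chart_at A (X i) c /\
    closed_ball (chart_map c x) r%:num (chart_map c (X i)).
  exact: filterI (near_chart_at Xx cx') (near_chart_ball Xx cx' nb).
have h3 : \forall i \near Phi, chart_at A (X' i) c /\
    closed_ball (chart_map c x) r%:num (chart_map c (X' i)).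
  exact: filterI (near_chart_at X'x cx') (near_chart_ball X'x cx' nb).
suff main i : (forall s y, (size s <= 2)%N -> closed_ball (chart_map c x) r%:num y ->
    `|iter_partial s (rep c (pfun (g i))) y - iter_partial s (rep c (pfun F)) y| < e) ->
    chart_at A (X i) c /\ closed_ball (chart_map c x) r%:num (chart_map c (X i)) ->
    chart_at A (X' i) c /\ closed_ball (chart_map c x) r%:num (chart_map c (X' i)) ->
    crit (pfun (g i)) (X i) -> crit (pfun (g i)) (X' i) -> X i = X' i.
  apply: (@filterS3 _ (nbhs Phi) FPhi _ _ _ _ main); [exact: h1|exact: h2|exact: h3].
move=> H [ci yK] [c'i y'K] gX gX'.
set y := chart_map c (X i) in yK; set y' := chart_map c (X' i) in y'K.
suff D0 : y' - y = 0.
  apply: (chart_inj mA Ac); rewrite ?inE; [exact: ci.2|exact: c'i.2|].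
  by apply/esym/eqP; rewrite -subr_eq0 -/y -/y' D0.
set D := y' - y.
have sg := pfun_smooth mA (g i) Ac.
have small k : `|(D *m H0) 0 k| <= n%:R * (2 * e) * `|D|.
  have [|w wb E] := @increment R n ('D_(basis_row k) (rep c (pfun (g i)))) y y'.
    move=> w wb j; apply: (smooth_on_derivable (smooth_on_partial k sg)).
    apply: rU; apply/(closed_ballP _ _ (gt0 r)).
    by apply: (boxed_dist wb); apply/closed_ballP.
  have {}E : \sum_j D 0 j * iter_partial [:: j; k] (rep c (pfun (g i))) (w j) = 0.
    by rewrite -E gX // gX' // subrr.
  have -> : (D *m H0) 0 k =
      \sum_j D 0 j * (H0 j k - iter_partial [:: j; k] (rep c (pfun (g i))) (w j)).
    under [RHS]eq_bigr do rewrite mulrBr.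
    by rewrite sumrB E subr0 mxE.
  apply: le_trans (ler_norm_sum _ _ _) _.
  have -> : n%:R * (2 * e) * `|D| = \sum_(j < n) `|D| * (2 * e).
    by rewrite sumr_const card_ord -[RHS]mulr_natl; ring.
  apply: ler_sum => j _; rewrite normrM; apply: ler_pM => //; first exact: norm_coord.
  have wK : closed_ball (chart_map c x) r%:num (w j).
    by apply/(closed_ballP _ _ (gt0 r)); apply: (boxed_dist (wb j)); apply/closed_ballP.
  have a1 := H [:: j; k] (w j) isT wK; have [_ /(_ j k) a2] := rP _ wK.
  rewrite -(subrKA (iter_partial [:: j; k] (rep c (pfun F)) (w j))).
  apply: le_trans (ler_normD _ _) _; rewrite [2 * e]mulr_natl mulr2n.
  by apply: lerD; rewrite distrC ltW.
have DE : D = (D *m H0) *m invmx H0 by rewrite mulmxK.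
have : `|D| <= `|D| / 2.
  apply: norm_rV_le => [|k]; first by rewrite divr_ge0.
  rewrite {1}DE mxE; apply: le_trans (ler_norm_sum _ _ _) _.
  apply: (@le_trans _ _ (\sum_j n%:R * (2 * e) * `|D| * `|invmx H0 j k|)).
    by apply: ler_sum => j _; rewrite normrM ler_wpM2r.
  rewrite -mulr_sumr.
  have Ck : \sum_j `|invmx H0 j k| <= C.
    by rewrite /C [leRHS](bigD1 k) //= lerDl sumr_ge0 // => l _; exact: sumr_ge0.
  apply: (@le_trans _ _ (n%:R * (2 * e) * `|D| * C)).
    by rewrite ler_wpM2l // !mulr_ge0 // ltW.
  have -> : n%:R * (2 * e) * `|D| * C = `|D| / 2 * (n%:R * C / (n%:R * C + 1)).
    by rewrite /e; field; rewrite gt_eqF.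
  by rewrite ler_piMr ?divr_ge0 // ler_pdivrMr // mul1r lerDl.
move=> h; apply/eqP; rewrite -normr_le0; have := normr_ge0 D; lra.
Qed.

End JointLimits.

(** * Openness *)

(** If the whole space were outside the ideal [Q], the complements of its members would form a
    proper filter, and a cluster point of it would have no neighbourhood in [Q]. This passes from
    local to global without handling finite covers. *)
Lemma compact_ideal (T : topologicalType) (Q : set T -> Prop) :
  compact [set: T] -> Q set0 -> (forall S S', S `<=` S' -> Q S' -> Q S) ->
  (forall S S', Q S -> Q S' -> Q (S `|` S')) ->
  (forall x : T, exists2 V, nbhs x V & Q V) -> Q setT.
Proof.
move=> cT Q0 QS QU Qloc; apply: contrapT => nQ.
have PF : ProperFilter [set S | Q (~` S)].
  split; first by rewrite /= setC0.
  split => [|S S' /= QSc QS'c|S S' SS' /=]; first by rewrite /= setCT.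
    by rewrite setCI; exact: QU.
  by apply: QS; exact: subsetC.
have [|x [_ clx]] := cT _ PF; first by rewrite /= setCT.
have [V nV QV] := Qloc x.
have [y [/= nVy Vy]] : (~` V) `&` V !=set0.
  by apply: clx => //=; rewrite setCK.
exact: nVy.
Qed.

Section Openness.
Context {R : realType} {n : nat} {N : topologicalType} {A : set (chart R n N)}.
Hypothesis mA : smooth_manifold A.
Hypothesis cN : compact [set: N].
Implicit Types (F G : pseudo_functions A).

(** The covering form of compactness asks only for a joint neighbourhood of each [x] and [F], which
    is [near_nondeg] for the product filter with its two projections. *)
Lemma nondeg_near F (S : set N) : compact S -> (forall x, S x -> nondeg F x) ->
  \forall G \near F, forall x, S x -> nondeg G x.
Proof.
move=> /compact_near_coveringP cS nF.
have FF := nbhs_filter F.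
apply: (cS _ (nbhs F) (fun G x => nondeg G x) FF) => x Sx.
have [c Ac cx] := chart_exists mA x.
have FFx := nbhs_filter x.
exact: (@near_nondeg _ _ _ _ mA _ (filter_prod (nbhs x) (nbhs F)) _ snd F cvg_snd fst x c cvg_fst
  (conj Ac cx) (nF x Sx)).
Qed.

(** A point that is not critical for [F] remains noncritical for nearby points and functions, so
    only pairs of critical points of [F] need an estimate. *)
Lemma simple_morse_near F : simple_morse (cover_atlas A) (pfun F) ->
  \forall G \near F, simple_morse (cover_atlas A) (pfun G).
Proof.
move=> /(simple_morseP mA)[nF zF dF].
have FF := nbhs_filter F.
have h1 := nondeg_near cN (fun x _ => nF x).
have : \forall G \near F, [set: N * N] `<=` (fun z =>
    (crit (pfun G) z.1 -> nonzero_value G z.1) /\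
    (crit (pfun G) z.1 -> crit (pfun G) z.2 -> z.1 <> z.2 -> distinct_values G z.1 z.2)).
  have /compact_near_coveringP cNN : compact [set: N * N].
    by rewrite -setXTT; exact: compact_setX.
  apply: (cNN _ (nbhs F) _ FF) => -[x x'] _.
  have FFx := nbhs_filter (x, x').
  pose Phi := filter_prod (nbhs (x, x')) (nbhs F).
  have FPhi : Filter Phi by exact: filter_prod_filter.
  suff : \forall w \near Phi,
      (crit (pfun w.2) w.1.1 -> nonzero_value w.2 w.1.1) /\
      (crit (pfun w.2) w.1.1 -> crit (pfun w.2) w.1.2 -> w.1.1 <> w.1.2 ->
        distinct_values w.2 w.1.1 w.1.2) by [].
  have gF : w.2 @[w --> Phi] --> F by exact: cvg_snd.
  have X1 : w.1.1 @[w --> Phi] --> x.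
    by apply: (@cvg_comp _ _ _ (fun w : (N * N) * _ => w.1) fst _ _ _ cvg_fst); exact: cvg_fst.
  have X2 : w.1.2 @[w --> Phi] --> x'.
    by apply: (@cvg_comp _ _ _ (fun w : (N * N) * _ => w.1) snd _ _ _ cvg_fst); exact: cvg_snd.
  have [c Ac cx] := chart_exists mA x; have [c' Ac' c'x'] := chart_exists mA x'.
  have [Fx|nFx] := pselect (crit (pfun F) x); last first.
    have h : \forall w \near Phi, ~ crit (pfun w.2) w.1.1.
      exact: (near_noncrit mA gF X1 (conj Ac cx) nFx).
    by apply: filterS h => w nw; split => // cw; case: nw.
  have Z : \forall w \near Phi, nonzero_value w.2 w.1.1.
    exact: (near_nonzero_value mA gF X1 (conj Ac cx) (zF x Fx)).
  have [Fx'|nFx'] := pselect (crit (pfun F) x'); last first.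
    have h : \forall w \near Phi, ~ crit (pfun w.2) w.1.2.
      exact: (near_noncrit mA gF X2 (conj Ac' c'x') nFx').
    by apply: filterS2 h Z => w nw zw; split => // _ cw; case: nw.
  have [xx'|xx'] := pselect (x = x').
    subst x'.
    have h : \forall w \near Phi, crit (pfun w.2) w.1.1 -> crit (pfun w.2) w.1.2 ->
        w.1.1 = w.1.2 by exact: (near_unique_crit mA gF X1 X2 Fx (nF x)).
    by apply: filterS2 h Z => w uw zw; split => // c1 c2; case; exact: uw.
  have h : \forall w \near Phi, distinct_values w.2 w.1.1 w.1.2.
    exact: (near_distinct_values mA gF X1 X2 (dF x x' Fx Fx' xx')).
  by apply: filterS2 h Z => w dw zw; split.
apply: filterS2 h1 => G nG H; apply/(simple_morseP mA); split.
- by move=> x; exact: nG.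
- by move=> x; exact: (H (x, x) I).1.
- by move=> x x'; exact: (H (x, x') I).2.
Qed.

Lemma simple_morse_open : open (simple_morse_pseudo_functions A).
Proof.
rewrite openE => F sF.
exact: (simple_morse_near sF).
Qed.

End Openness.

(** * Density *)

(** Sard's theorem for the gradient of [f]. The value is negated because f + a.y is critical where
    the gradient equals -a. Dimension 0 is treated apart, since [sard] is stated in dimension n+1;
    there the empty matrix is invertible. *)
Lemma sard_gradient (R : realType) n (U : set 'rV[R]_n) (f : 'rV[R]_n -> R) y0 (r e : R) :
  open U -> 0 < r -> closed_ball y0 r `<=` U -> smooth_on U f -> 0 < e ->
  exists2 a : 'rV[R]_n, `|a| <= e & forall y, `|y - y0| <= r ->
    (forall i, 'D_(basis_row i) f y + a 0 i = 0) ->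
    \matrix_(i, j) iter_partial [:: i; j] f y \in unitmx.
Proof.
case: n U f y0 => [|n] U f y0 oU r0 KU sf e0.
  by exists 0 => [|y _ _]; rewrite ?normr0 ?(ltW e0) // unitmxE det_mx00 unitr1.
have [a ae Ha] := sard r0 KU (fun i => smooth_on_partial i sf) e0.
exists (- a) => [|y yr H]; first by rewrite normrN.
(* The rows of [jacmx] are indexed by the components of the gradient, so it is the transpose of the
   matrix in the statement. *)
rewrite -unitmx_tr unitmxE unitfE.
have -> : (\matrix_(i, j) iter_partial [:: i; j] f y)^T =
    jacmx (fun i => 'D_(basis_row i) f) y by apply/matrixP => i j; rewrite [LHS]mxE [LHS]mxE [RHS]mxE.
apply: Ha => // i.
by apply/eqP; have := H i; rewrite mxE => /eqP; rewrite subr_eq0.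
Qed.

Section MorseDensity.
Context {R : realType} {n : nat} {N : topologicalType} {A : set (chart R n N)}.
Hypothesis mA : smooth_manifold A.
Hypothesis cN : compact [set: N].
Implicit Types (F G : pseudo_functions A).

(* Requiring nondegeneracy on a whole neighbourhood of G makes this stable under
   finite unions of sets S, unlike mere density. *)
Definition generically_nondeg (S : set N) := forall F (W : set (pseudo_functions A)),
  nbhs F W -> exists2 G, W G & \forall G' \near G, forall x, S x -> nondeg G' x.

(** The second perturbation is chosen inside the set of functions near which nondegeneracy on [S]
    persists. *)
Lemma generically_nondegU S S' : generically_nondeg S -> generically_nondeg S' ->
  generically_nondeg (S `|` S').
Proof.
move=> gS gS' F W nW.
have [G WG nG] := gS F _ (nbhs_interior nW).
have nWG : nbhs G (W `&` [set G' | nbhs G' [set H | forall x, S x -> nondeg H x]]).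
  by apply: filterI => //; exact: nbhs_interior nG.
have [G' [WG' nG'] nG'S'] := gS' G _ nWG.
exists G' => //; apply: filterS2 nG' nG'S' => H h h' x [/h|/h'];  exact.
Qed.

Lemma generically_nondeg_local (x : N) : exists2 S, nbhs x S & generically_nondeg S.
Proof.
have [c Ac cx] := chart_exists mA x.
have oI := chart_img_open mA Ac.
have Ix : chart_img c (chart_map c x) by exists x.
have [b [r r0 [C [sb cC CI bC b0]]]] := exists_bump oI Ix.
(* The radius is halved so that the bump is 1 in a neighbourhood of each point of the smaller closed
   ball, where the perturbation is then exactly linear. *)
have r20 : 0 < r / 2 by rewrite divr_gt0.
set y0 := chart_map c x in bC *.
have KI : closed_ball y0 r `<=` chart_img c.
  by move=> y /(closed_ballP _ _ r0) /bC[/CI].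
have KI2 : closed_ball y0 (r / 2) `<=` chart_img c.
  move=> y /(closed_ballP _ _ r20) yr; apply: KI; apply/closed_ballP => //.
  by apply: le_trans yr _; lra.
have cK := @compact_closed_ball _ _ y0 _ r20.
exists [set x' | chart_dom c x' /\ closed_ball y0 (r / 2) (chart_map c x')].
  apply: (chart_near mA Ac cx); apply/nbhs_closedballP.
  by exists (PosNum r20).
move=> F W nW.
pose phi (k : 'I_n) : 'rV[R]_n -> R := b * (fun y => y 0 k).
have sphi k : smooth_on setT (phi k).
  exact: (smooth_onM openT sb (smooth_on_rV_coord k openT)).
have phi0 k y : ~ C y -> phi k y = 0 by move=> /b0 by0; rewrite /phi mulrfctE by0 mul0r.
have exG k : exists G : pseudo_functions A, pfun G = bump_pseudo c (phi k).
  exact: (exists_bump_pseudo mA Ac (sphi k) cC CI (@phi0 k)).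
have [G GE] := choice exG.
have repG k : rep c (pfun (G k)) = phi k by rewrite GE; exact: (rep_bump_pseudo mA Ac CI (@phi0 k)).
have [pert [pertE pertF]] := exists_perturbation mA F G.
have /nbhs_ballP[e /= e0 eW] : nbhs (0 : 'rV[R]_n) (pert @^-1` W) by exact: (pertF _ nW).
have e20 : 0 < e / 2 by rewrite divr_gt0.
have [a ae Ha] := sard_gradient oI r20 KI2 (pfun_smooth mA F Ac) e20.
have rep_pert y : `|y - y0| <= r / 2 -> \forall z \near y,
    rep c (pfun (pert a)) z = (rep c (pfun F) + \sum_k a 0 k *: (fun z : 'rV[R]_n => z 0 k)) z.
  move=> yr; have : \forall z \near y, `|z - y0| <= r.
    suff : nbhs y [set z | `|z - y0| <= r] by [].
    apply/nbhs_ballP; exists (r / 2) => // z; rewrite -ball_normE /= => yz.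
    rewrite -(subrKA y) (le_trans (ler_normD _ _)) // (splitr r) lerD // distrC; exact: ltW.
  apply: filterS => z /bC[_ bz].
  rewrite pertE (rep_lin mA _ _ _ Ac) !addrfctE !fct_sumE; congr (_ + _).
  by apply: eq_bigr => k _; rewrite !scalrfctE repG /phi mulrfctE bz mul1r.
pose l := \sum_k a 0 k *: (fun z : 'rV[R]_n => z 0 k).
have D1 y j : is_derive y (basis_row j) l (a 0 j).
  have dc k : is_derive y (basis_row j) (a 0 k *: (fun z : 'rV[R]_n => z 0 k))
      (a 0 k *: (j == k)%:R).
    have := smooth_on_is_derive j (@smooth_on_rV_coord R n setT k openT) (I : setT y).
    by rewrite partial_coordE => d; exact: is_deriveZ.
  apply: is_derive_eq (is_derive_sum dc) _.
  rewrite (bigD1 j) //= eqxx big1 ?addr0; first by rewrite [_ *: _]mulr1.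
  by move=> k kj; rewrite eq_sym (negbTE kj) scaler0.
exists (pert a).
  by apply: eW; rewrite -ball_normE /= sub0r normrN (le_lt_trans ae) //; lra.
apply: (nondeg_near mA).
  exact: (compact_chart_preimage mA Ac cK KI2).
move=> x' [cx' /(closed_ballP _ _ r20) Kx'].
have Ix' : chart_img c (chart_map c x') by exists x'.
have sF := pfun_smooth mA F Ac.
have partial_pert j : \forall z \near chart_map c x',
    'D_(basis_row j) (rep c (pfun (pert a))) z = ('D_(basis_row j) (rep c (pfun F)) + cst (a 0 j)) z.
  have nI : \forall z \near chart_map c x', chart_img c z by apply: near_open oI Ix' _.
  apply: filterS2 nI (nbhs_interior (rep_pert _ Kx')) => z Iz E.
  rewrite (near_eq_derive _ E).
  have d1 := smooth_on_is_derive j sF Iz; have d2 := D1 z j.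
  by have [] := is_deriveD d1 d2.
move=> crx; apply: (nondeg_chart mA (conj Ac cx')) => //.
(* A linear term has no second derivatives, so the Hessian to be inverted is that of [F], about
   which [sard_gradient] speaks. *)
have -> : hess c (pfun (pert a)) (chart_map c x') =
    \matrix_(i, j) iter_partial [:: i; j] (rep c (pfun F)) (chart_map c x').
  apply/matrixP => i j; rewrite [LHS]mxE [RHS]mxE /= (near_eq_derive _ (partial_pert j)).
  have d1 := smooth_on_is_derive i (smooth_on_partial j sF) Ix'.
  have d2 := is_derive_cst (a 0 j) (chart_map c x') (basis_row i).
  by have [_ ->] := is_deriveD d1 d2; rewrite addr0.
apply: Ha => // i.
have := crx c (conj Ac cx') i.
by rewrite (nbhs_singleton (partial_pert i)).
Qed.

Lemma generically_nondegT : generically_nondeg setT.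
Proof.
apply: (compact_ideal cN).
- by move=> F W nW; exists F; [exact: nbhs_singleton|near=> G => x].
- move=> S S' SS' gS' F W /gS'[G WG nG]; exists G => //.
  by apply: filterS nG => G' H x /SS'; exact: H.
- exact: generically_nondegU.
- exact: generically_nondeg_local.
Unshelve. all: by end_near. Qed.

End MorseDensity.

(** An affine function of slope b has a single zero. It may be t = 0, hence the punctured
    neighbourhood. *)
Lemma near_affine_neq0 (R : realType) (a b : R) : b != 0 ->
  \forall t \near (0 : R)^', a + t * b != 0.
Proof.
move=> b0; have [->|a0] := eqVneq a 0.
  near=> t; rewrite add0r mulf_neq0 //; near: t; exact: nbhs_dnbhs_neq.
have L : a + t * b @[t --> (0 : R)^'] --> a + 0 * b.
  apply: cvgD; first exact: cvg_cst.
  by apply: cvgM; [exact: nbhs_dnbhs|exact: cvg_cst].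
have a0' : a + 0 * b != 0 by rewrite mul0r addr0.
exact: (near_neq0 L a0').
Unshelve. all: by end_near. Qed.

Lemma neq_norm (R : realType) (a b : R) : a - b != 0 -> a + b != 0 -> `|a| != `|b|.
Proof.
move=> h1 h2; apply/eqP => E; have : a ^+ 2 == b ^+ 2.
  by rewrite -real_normK ?num_real // E real_normK ?num_real.
by rewrite eqf_sqr -subr_eq0 (negbTE h1) -subr_eq0 opprK (negbTE h2).
Qed.

Section Density.
Context {R : realType} {n : nat} {N : topologicalType} {A : set (chart R n N)}.
Hypothesis mA : smooth_manifold A.
Hypothesis cN : compact [set: N].
Implicit Types (F G : pseudo_functions A) (x : N).

(** For critical [x] this is [near_unique_crit] for the constant family [F], with one point tending
    to [x] and the other fixed at [x]. *)
Lemma crit_isolated F x : nondeg F x ->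
  \forall x' \near x, crit (pfun F) x' -> x' = x.
Proof.
move=> ndx; have FF := nbhs_filter x.
have [c Ac cx] := chart_exists mA x.
have gF : (fun=> F) x' @[x' --> x] --> F by exact: cvg_cst.
have [Fx|nFx] := pselect (crit (pfun F) x).
  have h : \forall x' \near x, crit (pfun F) x' -> crit (pfun F) x -> x' = x.
    exact: (@near_unique_crit _ _ _ _ mA _ (nbhs x) FF (fun=> F) F gF id (fun=> x) x
      cvg_id (cvg_cst _) Fx ndx).
  by apply: filterS h => x' H cx'; exact: H.
have h : \forall x' \near x, ~ crit (pfun F) x'.
  exact: (@near_noncrit _ _ _ _ mA _ (nbhs x) FF (fun=> F) F gF id x c cvg_id (conj Ac cx) nFx).
by apply: filterS h => x' H /H.
Qed.

(** The sets containing only finitely many critical points form an ideal, and isolation puts a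
    neighbourhood of every point into it. *)
Lemma crit_finite F : (forall x, nondeg F x) -> finite_set [set x | crit (pfun F) x].
Proof.
move=> nF.
suff : finite_set ([set x | crit (pfun F) x] `&` setT) by rewrite setIT.
apply: (@compact_ideal N (fun S => finite_set ([set x | crit (pfun F) x] `&` S)) cN).
- by rewrite setI0.
- by move=> S S' SS'; apply: sub_finite_set; exact: setIS.
- by move=> S S' fS fS'; rewrite setIUr finite_setU.
- move=> x; exists [set x' | crit (pfun F) x' -> x' = x]; first exact: crit_isolated.
  by apply: (@sub_finite_set _ _ [set x]) => // x' [/= Fx' /(_ Fx')].
Qed.

(** The bump is supported where [x] is the only critical point of [F]. It is thus locally constant
    in charts near every critical point of [F], and adding a multiple of it keeps all of them
    critical. *)
Lemma exists_spike F x : (forall x, nondeg F x) -> crit (pfun F) x ->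
  exists G c, [/\ chart_at A x c,
    \forall y \near chart_map c x, rep c (pfun G) y = 1 &
    forall x', crit (pfun F) x' -> x' <> x -> forall c', chart_at A x' c' ->
      \forall y \near chart_map c' x', rep c' (pfun G) y = 0].
Proof.
move=> nF Fx; have [c Ac cx] := chart_exists mA x.
have := chart_inv_near mA Ac cx (crit_isolated (nF x)).
set P := (X in \forall y \near _, X y).
move=> nP; pose U := interior (P : set 'rV[R]_n).
have oU : open U by exact: open_interior.
have Ux : U (chart_map c x) by exact: nP.
have [b [r r0 [C [sb cC CU bC b0]]]] := exists_bump oU Ux.
have CI : C `<=` chart_img c.
  by move=> y /CU /interior_subset[x' [cx' <- _]]; exists x'.
have [G GE] := exists_bump_pseudo mA Ac sb cC CI b0.
exists G, c; split => //.
  rewrite GE (rep_bump_pseudo mA Ac CI b0).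
  suff : nbhs (chart_map c x) [set y | b y = 1] by [].
  apply/nbhs_ballP; exists r => // y; rewrite -ball_normE /= => yr.
  by have [] := bC y _; rewrite // distrC ltW.
move=> x' Fx' x'x c' c'x'.
have nx' : ~ (chart_dom c x' /\ C (chart_map c x')).
  move=> [cx' /CU /interior_subset[x'' [cx'' E]]].
  have -> : x'' = x' by apply: (chart_inj mA Ac); rewrite ?inE.
  by move=> /(_ Fx').
have nP' : \forall x'' \near x', ~ (chart_dom c x'' /\ C (chart_map c x'')).
  apply: open_nbhs_nbhs; split => //.
  exact: (closed_openC (closed_chart_preimage mA Ac cC CI)).
apply: filterS (chart_inv_near mA c'x'.1 c'x'.2 nP') => _ [x'' [c'x'' <- nx'']].
have [w wp] := chart_orientation mA true (conj c'x'.1 c'x'').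
rewrite (@repE _ _ _ _ mA c' x'' w) //; [|exact: c'x'.1|exact/wp].
by rewrite GE (bump_pseudo_out b0).
Qed.

(** Near a critical point of [F] each [g t] differs from [F] by a constant in the chart, so it gains
    no critical point there; near any other point the gradient of [g t] is nonzero for small [t]. It
    remains to separate absolute values at the fixed points [pt j], where the values are affine in
    [t]. *)
Lemma exists_simple_morse_near F (W : set (pseudo_functions A)) :
  (forall x, nondeg F x) -> nbhs F W ->
  exists2 G, W G & simple_morse (cover_atlas A) (pfun G).
Proof.
move=> nF nW.
have [s sP] : exists s : seq N, forall x, crit (pfun F) x <-> x \in s.
  have /finite_seqP[s E] := crit_finite nF; exists s => x.
  by rewrite -[crit _ _]/([set x | crit (pfun F) x] x) E.
wlog us : s sP / uniq s.
  by move=> H; apply: (H (undup s)); rewrite ?undup_uniq // => x; rewrite mem_undup.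
pose pt (i : 'I_(size s)) : N := tnth (in_tuple s) i.
have pt_crit i : crit (pfun F) (pt i) by apply/sP; exact: mem_tnth.
have pt_inj i j : i != j -> pt i <> pt j.
  have /tuple_uniqP inj_tnth : uniq (in_tuple s) by [].
  by move=> ij /inj_tnth E; rewrite E eqxx in ij.
have spike i := exists_spike nF (pt_crit i).
have [G spikeG] := choice spike; have [ch chP] := choice spikeG.
have [pert [pertE pertF]] := exists_perturbation mA F G.
pose m : 'rV[R]_(size s) := \row_i i.+1%:R.
pose g (t : R) := pert (t *: m).
have gF : g t @[t --> (0 : R)^'] --> F.
  have L : t *: m @[t --> (0 : R)^'] --> (0 : 'rV[R]_(size s)).
    rewrite -(scale0r m); apply: cvgZr_tmp; exact: nbhs_dnbhs.
  exact: (cvg_comp _ _ L pertF).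
have rep_g j : \forall y \near chart_map (ch j) (pt j), forall t,
    rep (ch j) (pfun (g t)) y = (rep (ch j) (pfun F) + cst (t * j.+1%:R)) y.
  have [cj nj _] := chP j.
  have nG i : \forall y \near chart_map (ch j) (pt j), rep (ch j) (pfun (G i)) y = (i == j)%:R.
    have [->|ij] := eqVneq i j; first exact: nj.
    have [_ _ H] := chP i; apply: H => //.
    by apply: pt_inj; rewrite eq_sym.
  apply: filterS (@filter_forall _ _ _ _ (nbhs_filter (chart_map (ch j) (pt j))) nG) => y H t.
  rewrite pertE (rep_lin mA _ _ _ cj.1) !addrfctE !fct_sumE; congr (_ + _).
  rewrite (bigD1 j) //= big1 => [|i ij]; rewrite !scalrfctE H.
    by rewrite eqxx addr0 !mxE [_ *: _]mulr1.
  by rewrite (negbTE ij) scaler0.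
have value_g j t : rep (ch j) (pfun (g t)) (chart_map (ch j) (pt j)) =
    rep (ch j) (pfun F) (chart_map (ch j) (pt j)) + t * j.+1%:R.
  by rewrite (nbhs_singleton (rep_g j)).
(* The neighbourhood does not depend on [t], so it can be used before [t] is chosen. *)
have crit_g j : \forall x \near pt j, forall t, crit (pfun (g t)) x -> x = pt j.
  have [cj _ _] := chP j.
  have h1 := chart_near mA cj.1 cj.2 (nbhs_interior (rep_g j)).
  apply: filterS2 h1 (crit_isolated (nF (pt j))) => x [cjx E] isol t cgx.
  apply: isol.
  apply: (crit_chart mA (pfun_odd F) (@pfun_smooth _ _ _ _ mA F) (conj cj.1 cjx)) => i.
  have Et : \forall y \near chart_map (ch j) x,
      rep (ch j) (pfun (g t)) y = (rep (ch j) (pfun F) + cst (t * j.+1%:R)) y.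
    by apply: filterS E => y; exact.
  have := cgx (ch j) (conj cj.1 cjx) i; rewrite (near_eq_derive _ Et).
  have d1 := smooth_on_is_derive i (pfun_smooth mA F cj.1)
    (ex_intro2 _ _ x cjx erefl : chart_img (ch j) (chart_map (ch j) x)).
  have d2 := is_derive_cst (t * j.+1%:R) (chart_map (ch j) x) (basis_row i).
  by have [_ ->] := is_deriveD d1 d2; rewrite addr0.
have crit_pt x : crit (pfun F) x -> exists j, x = pt j.
  by move=> /sP xs; have /tnthP[j ->] : x \in in_tuple s by []; exists j.
have h1 : \forall t \near (0 : R)^', forall x, setT x -> nondeg (g t) x.
  exact: (gF _ (nondeg_near mA cN (fun x _ => nF x))).
have h2 : \forall t \near (0 : R)^', W (g t) by exact: (gF _ nW).
(* Compactness of the product of [N] with itself, against the filter of punctured neighbourhoods of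
   0, makes the same small [t] work for all pairs of points. *)
have h3 : \forall t \near (0 : R)^', [set: N * N] `<=` (fun z =>
    (crit (pfun (g t)) z.1 -> nonzero_value (g t) z.1) /\
    (crit (pfun (g t)) z.1 -> crit (pfun (g t)) z.2 -> z.1 <> z.2 ->
      distinct_values (g t) z.1 z.2)).
  have /compact_near_coveringP cNN : compact [set: N * N].
    by rewrite -setXTT; exact: compact_setX.
  have FF : Filter (0 : R)^' by exact: dnbhs_filter.
  apply: (cNN _ ((0 : R)^') _ FF) => -[x x'] _.
  have FFx := nbhs_filter (x, x').
  pose Phi := filter_prod (nbhs (x, x')) ((0 : R)^').
  have FPhi : Filter Phi by exact: filter_prod_filter.
  suff : \forall w \near Phi,
      (crit (pfun (g w.2)) w.1.1 -> nonzero_value (g w.2) w.1.1) /\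
      (crit (pfun (g w.2)) w.1.1 -> crit (pfun (g w.2)) w.1.2 -> w.1.1 <> w.1.2 ->
        distinct_values (g w.2) w.1.1 w.1.2) by [].
  have gPhi : g w.2 @[w --> Phi] --> F.
    by apply: (cvg_comp _ _ _ gF); exact: cvg_snd.
  have X1 : w.1.1 @[w --> Phi] --> x.
    by apply: (@cvg_comp _ _ _ (fun w : (N * N) * _ => w.1) fst _ _ _ cvg_fst); exact: cvg_fst.
  have X2 : w.1.2 @[w --> Phi] --> x'.
    by apply: (@cvg_comp _ _ _ (fun w : (N * N) * _ => w.1) snd _ _ _ cvg_fst); exact: cvg_snd.
  have T1 (P : R -> Prop) : (\forall t \near (0 : R)^', P t) -> \forall w \near Phi, P w.2.
    by move=> nP; exact: (cvg_snd nP).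
  have [c Ac cx] := chart_exists mA x; have [c' Ac' c'x'] := chart_exists mA x'.
  have [/crit_pt[j xj]|nFx] := pselect (crit (pfun F) x); last first.
    have h : \forall w \near Phi, ~ crit (pfun (g w.2)) w.1.1.
      exact: (near_noncrit mA gPhi X1 (conj Ac cx) nFx).
    by apply: filterS h => w nw; split => // cw; case: nw.
  have C1 : \forall w \near Phi, crit (pfun (g w.2)) w.1.1 -> w.1.1 = pt j.
    have h : \forall w \near Phi, forall t, crit (pfun (g t)) w.1.1 -> w.1.1 = pt j.
      by apply: (X1 [set x | forall t, crit (pfun (g t)) x -> x = pt j]); rewrite xj; exact: crit_g.
    by apply: filterS h => w; exact.
  have Z : \forall w \near Phi, nonzero_value (g w.2) (pt j).
    have [cj _ _] := chP j.
    have := T1 _ (@near_affine_neq0 R (rep (ch j) (pfun F) (chart_map (ch j) (pt j))) j.+1%:R _).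
    rewrite pnatr_eq0 => /(_ isT); apply: filterS => w nz.
    by apply: (nonzero_value_chart mA cj); rewrite value_g.
  have [/crit_pt[j' xj']|nFx'] := pselect (crit (pfun F) x'); last first.
    have h : \forall w \near Phi, ~ crit (pfun (g w.2)) w.1.2.
      exact: (near_noncrit mA gPhi X2 (conj Ac' c'x') nFx').
    apply: filterS3 C1 Z h => w c1 zw nw; split => [/c1 -> //|_ cw].
    by case: nw.
  have C2 : \forall w \near Phi, crit (pfun (g w.2)) w.1.2 -> w.1.2 = pt j'.
    have h : \forall w \near Phi, forall t, crit (pfun (g t)) w.1.2 -> w.1.2 = pt j'.
      by apply: (X2 [set x | forall t, crit (pfun (g t)) x -> x = pt j']); rewrite xj'; exact: crit_g.
    by apply: filterS h => w; exact.
  have [jj'|jj'] := eqVneq j j'.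
    subst j'; apply: filterS3 C1 C2 Z => w c1 c2 zw; split => [/c1 -> //|/c1 -> /c2 ->].
    by case.
  have D : \forall w \near Phi, distinct_values (g w.2) (pt j) (pt j').
    have [cj _ _] := chP j; have [cj' _ _] := chP j'.
    pose v := rep (ch j) (pfun F) (chart_map (ch j) (pt j)).
    pose v' := rep (ch j') (pfun F) (chart_map (ch j') (pt j')).
    have m1 : j.+1%:R - j'.+1%:R != 0 :> R.
      by rewrite subr_eq0 eqr_nat eqSS.
    have m2 : j.+1%:R + j'.+1%:R != 0 :> R by rewrite -natrD pnatr_eq0.
    have n1 := T1 _ (near_affine_neq0 (v - v') m1).
    have n2 := T1 _ (near_affine_neq0 (v + v') m2).
    apply: filterS2 n1 n2 => w n1 n2.
    apply: (distinct_values_chart mA cj cj'); rewrite !value_g -/v -/v'.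
    apply: neq_norm.
      by rewrite (_ : _ - _ = v - v' + w.2 * (j.+1%:R - j'.+1%:R)) //; ring.
    by rewrite (_ : _ + _ = v + v' + w.2 * (j.+1%:R + j'.+1%:R)) //; ring.
  have CC : \forall w \near Phi, (crit (pfun (g w.2)) w.1.1 -> w.1.1 = pt j) /\
    (crit (pfun (g w.2)) w.1.2 -> w.1.2 = pt j') by exact: filterI C1 C2.
  by apply: filterS3 CC Z D => w [c1 c2] zw dw; split => [/c1 ->|/c1 -> /c2 ->].
have PF : ProperFilter ((0 : R)^') by exact: Proper_dnbhs_numFieldType.
have [t [nt [Wt Ht]]] := @filter_ex _ _ PF _ (filterI h1 (filterI h2 h3)).
exists (g t) => //; apply/(simple_morseP mA); split.
- by move=> x; exact: nt.
- by move=> x; exact: (Ht (x, x) I).1.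
- by move=> x x'; exact: (Ht (x, x') I).2.
Qed.

Lemma simple_morse_dense : dense (simple_morse_pseudo_functions A).
Proof.
move=> W [F WF] oW.
have nW : nbhs F W by exact: open_nbhs_nbhs.
have [G WG nG] := generically_nondegT mA cN nW.
have [|H WH sH] := @exists_simple_morse_near G W (fun x => nbhs_singleton nG x I).
  exact: open_nbhs_nbhs.
by exists H.
Qed.

End Density.

Theorem theorem1p1 (R : realType) (n : nat) (N : topologicalType)
    (A : set (chart R n N))
    (N_manifold : smooth_manifold A)
    (N_compact : compact [set: N])
    (N_nonorientable : ~ orientable A) :
  open (simple_morse_pseudo_functions A) /\
  dense (simple_morse_pseudo_functions A).
Proof.
split; first exact: simple_morse_open.
exact: simple_morse_dense.
Qed.
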